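(* For every $d \geq 3$, $k \geq d$ and $\varepsilon > 0$, there is a family $\mathcal{F}$ of finite graphs satisfying the following, where $$s(d,k) = d-1 + (k-d)\left(1-\frac{1}{d-1}\right).$$ 1. For some $\tilde{k} \leq k+\varepsilon$ and every $G \in \mathcal{F}$, $$|B_G(x,R)| \asymp_{d,\varepsilon} R^{\tilde{k}}, \qquad \forall x \in V(G),\ 1 \leq R \leq \mathrm{diam}(G).$$ 2. Each $G \in \mathcal{F}$ is $M$-uniformly sphere-packed in $\mathbb{R}^d$ for some $M \lesssim_{d,\varepsilon} 1$. 3. There is a number $c \gtrsim_{d,\varepsilon} 1$ such that for every $G \in \mathcal{F}$ and $x \in V(G)$, there are at least $c R^{s(d,k)}$ vertex-disjoint paths from $S_G(x,R)$ to $S_G(x,R')$ for all integers $R, R'$ with $1 \leq R < R' \leq c\, \mathrm{diam}(G)$.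
   Context: Graphs are connected and undirected, and equipped with the path metric $d_G$. Write $B_G(x,R) = \{y \in V(G) : d_G(x,y) \leq R\}$, $S_G(x,R) = \{y \in V(G) : d_G(x,y) = R\}$, and $\mathrm{diam}(G) = \sup_{x,y \in V(G)} d_G(x,y)$. The notation $A \lesssim_{d,\varepsilon} B$ (equivalently $B \gtrsim_{d,\varepsilon} A$) means that $A \leq C(d,\varepsilon)\, B$, where $C(d,\varepsilon)$ is a number depending only on $d$ and $\varepsilon$; $A \asymp_{d,\varepsilon} B$ means that both $A \lesssim_{d,\varepsilon} B$ and $B \lesssim_{d,\varepsilon} A$ hold. A graph $G$ is $M$-uniformly sphere-packed in $\mathbb{R}^d$ if $G$ is the tangency graph of a collection of interior-disjoint spheres in $\mathbb{R}^d$ (the vertices are the spheres, and two spheres are adjacent exactly when they are tangent), where the collection can be taken such that the ratio of the radii of any two tangent spheres lies in the interval $[M^{-1},M]$.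
   Formalization: The family is required to have unbounded diameter, and the implied constants depend on d, ε and an upper bound K for k (uniformly for k in [d,K]), since constants depending only on d and ε are impossible for such families as k grows. *)

(* Defs.v *)
From mathcomp Require Import all_boot all_order all_algebra.
From mathcomp Require Import classical_sets reals exp.

Set Implicit Arguments.
Unset Strict Implicit.
Unset Printing Implicit Defensive.

Import Order.TTheory GRing.Theory Num.Theory.

Local Open Scope ring_scope.

Record sgraph := SGraph {
  vert :> finType;
  adj : rel vert;
  adj_sym : symmetric adj;
  adj_irr : irreflexive adj;
  vert_gt0 : (0 < #|vert|)%N;
  adj_connected : forall x y, connect adj x y }.

Definition walk (G : sgraph) (x y : G) (n : nat) : bool :=
  [exists p : n.-tuple G, path (@adj G) x p && (last x p == y)].

Lemma walk_ex (G : sgraph) (x y : G) : exists n, walk x y n.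
Proof.
have /connectP[p xp ->] := adj_connected x y.
by exists (size p); apply/existsP; exists (in_tuple p); rewrite xp eqxx.
Qed.

Definition gdist (G : sgraph) (x y : G) : nat := ex_minn (walk_ex x y).

Definition diam (G : sgraph) : nat := \max_(x : G) \max_(y : G) gdist x y.

Definition gball (R : realType) (G : sgraph) (x : G) (r : R) : {set G} :=
  [set y | (gdist x y)%:R <= r].

Definition gsphere (G : sgraph) (x : G) (n : nat) : {set G} :=
  [set y | gdist x y == n].

Definition path_between (G : sgraph) (A B : {set G}) (p : seq G) : bool :=
  if p is x :: q
  then [&& path (@adj G) x q, uniq p, x \in A & last x q \in B]
  else false.

Definition vertex_disjoint_paths (G : sgraph) (A B : {set G})
    (ps : seq (seq G)) : bool :=
  all (path_between A B) ps &&
  pairwise (fun p q : seq G => [disjoint p & q]) ps.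

(* The library norm on row vectors is the sup norm, hence this definition. *)
Definition edist (R : realType) (d : nat) (p q : 'rV[R]_d) : R :=
  Num.sqrt (\sum_(i < d) (p 0 i - q 0 i) ^+ 2).

Definition esphere (R : realType) (d : nat) (c : 'rV[R]_d) (r : R) :
  set 'rV[R]_d := [set p | edist p c = r]%classic.

Definition einterior (R : realType) (d : nat) (c : 'rV[R]_d) (r : R) :
  set 'rV[R]_d := [set p | edist p c < r]%classic.

(* For d >= 2 and positive radii, two spheres are tangent exactly when they
   have a single common point. *)
Definition tangent (R : realType) (d : nat) (c1 : 'rV[R]_d) (r1 : R)
    (c2 : 'rV[R]_d) (r2 : R) : Prop :=
  exists! p, esphere c1 r1 p /\ esphere c2 r2 p.

Definition sphere_packed (R : realType) (d : nat) (M : R) (G : sgraph) : Prop :=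
  exists (ctr : G -> 'rV[R]_d) (rad : G -> R),
    [/\ forall u, 0 < rad u,
        forall u v, u != v ->
          (einterior (ctr u) (rad u) `&` einterior (ctr v) (rad v) = set0)%classic,
        forall u v, u != v ->
          (adj u v <-> tangent (ctr u) (rad u) (ctr v) (rad v)) &
        forall u v, u != v -> tangent (ctr u) (rad u) (ctr v) (rad v) ->
          M^-1 <= rad u / rad v <= M].

Definition asymp (R : realType) (C a b : R) : Prop := a <= C * b /\ b <= C * a.

Definition sdk (R : realType) (d : nat) (k : R) : R :=
  d%:R - 1 + (k - d%:R) * (1 - (d%:R - 1)^-1).

(* Main.v *)
(* Cut the cube [0, H]^d, H = b L with b and L odd, into an L^d grid of coarse
   cubes of side b, and cut into unit cubes those coarse cubes that do not touch
   a lateral face (coordinate 0 is the vertical one).  Iterate this substitution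
   n times and take the tangency graph of the balls inscribed in the resulting
   cubes.
   - The lateral faces of a substituted cube always carry a regular grid of mesh
     L^-n, so neighbouring cubes have sides within a factor b, and in the graph
     metric a cube of generation n - j has diameter of order L^j.  Hence balls
     grow like R^(log N / log L), N being the number of pieces of one step.
   - The substitution is invariant under vertical translations, so the cubes
     are organised in disjoint vertical columns; at least ((b (L - 2))^(d-1))^j
     of them cross a given cube of generation n - j, and each of them has an end
     far from any given vertex.
   With L large and b close to L^(k/d - 1), the growth exponent is close to k and
   the path exponent is close to k (d - 1) / d >= s(d, k). *)
From HB Require Import structures.
Require Import Defs.
From mathcomp Require Import all_boot all_order all_algebra.
From mathcomp Require Import classical_sets reals exp.
From mathcomp Require Import zify ring lra.

Set Implicit Arguments.
Unset Strict Implicit.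
Unset Printing Implicit Defensive.

Import Order.TTheory GRing.Theory Num.Theory.

(** * Distances and paths in finite graphs *)

Section GraphDistance.
Variable G : sgraph.
Implicit Types (x y z : G) (s : seq G).

Lemma gdist_path x y :
  exists s, [/\ path (@adj G) x s, last x s = y & size s = gdist x y].
Proof.
rewrite /gdist; case: ex_minnP => k /existsP[s /andP[xs /eqP <-]] _.
by exists s; rewrite size_tuple.
Qed.

Lemma gdist_le x s : path (@adj G) x s -> gdist x (last x s) <= size s.
Proof.
move=> xs; rewrite /gdist; case: ex_minnP => k _; apply.
by apply/existsP; exists (in_tuple s); rewrite xs eqxx.
Qed.

Lemma gdistxx x : gdist x x = 0.
Proof. by apply/eqP; rewrite -leqn0; apply: (@gdist_le x [::]). Qed.

Lemma gdist_adj x y z : adj y z -> gdist x z <= (gdist x y).+1.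
Proof.
have [s [xs <- <-]] := gdist_path x y; rewrite -(size_rcons s z) => sz.
by rewrite -{1}(last_rcons x s z); apply: gdist_le; rewrite rcons_path xs.
Qed.

Lemma leq_diam x y : gdist x y <= diam G.
Proof.
by apply: leq_trans (leq_bigmax (F := fun z => \max_(y : G) gdist z y) x);
   apply: (leq_bigmax (F := gdist x)).
Qed.

Lemma diam_le k : (forall x y, gdist x y <= k) -> diam G <= k.
Proof. by move=> gk; apply/bigmax_leqP => x _; apply/bigmax_leqP => y _. Qed.

(** One step raises the distance to [x] by at most one, so no level is skipped: cut the path at its
    first vertex at distance [m], then at the next one at distance [n]. *)
Lemma crossing_path x y s m n : path (@adj G) y s -> uniq (y :: s) -> m <= n ->
  gdist x y <= m -> n <= gdist x (last y s) ->
  exists2 p, path_between (gsphere x m) (gsphere x n) p & {subset p <= y :: s}.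
Proof.
move=> ys uys mn xym nl.
have [z [s2 [zs uzs zm zl sub]]] : exists z s2, [/\ path (@adj G) z s2,
    uniq (z :: s2), gdist x z = m, last z s2 = last y s &
    {subset z :: s2 <= y :: s}].
  elim: s y ys uys xym nl => [|z s IH] y /=.
    by move=> _ _ ym nm; exists y, [::]; split=> //=; lia.
  move=> /andP[yz zs] /andP[ynz uzs] ym nl; move: ym; rewrite leq_eqVlt.
  case/orP=> [/eqP ym|ym].
    by exists y, (z :: s); split=> //=; [rewrite yz|rewrite ynz].
  have [|z' [s2 [? ? ? ? sub]]] := IH z zs uzs _ nl.
    exact: leq_trans (gdist_adj x yz) ym.
  by exists z', s2; split=> // i /sub; rewrite !inE => /orP[]->; rewrite !orbT.
have [s1 [zs1 us1 s1n sub1]] : exists s1, [/\ path (@adj G) z s1,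
    uniq (z :: s1), gdist x (last z s1) = n & {subset z :: s1 <= z :: s2}].
  rewrite -zl in nl; rewrite -zm in mn.
  elim: s2 z zs uzs nl mn {zm zl sub} => [|z' s2 IH] z.
    by move=> _ _ /= nz zn; exists [::]; split=> //=; lia.
  move=> /= /andP[zz' z's] /andP[znz uz's] nl zn; move: zn; rewrite leq_eqVlt.
  case/orP=> [/eqP zn|zn].
    by exists [::]; split=> //= i; rewrite !inE => ->.
  have [|s1 [ps1 us1 s1n sub]] := IH z' z's uz's nl.
    exact: leq_trans (gdist_adj x zz') zn.
  exists (z' :: s1); split=> //=; first by rewrite zz'.
    by apply/andP; split; [apply: contra znz => /sub|exact: us1].
  by move=> i; rewrite in_cons => /orP[/eqP->|/sub iz]; rewrite in_cons ?eqxx // iz orbT.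
exists (z :: s1); last by move=> i /sub1/sub.
by rewrite /= zs1 -[(z \notin s1) && _]/(uniq (z :: s1)) us1 !inE zm s1n !eqxx.
Qed.

End GraphDistance.

(** * Tangent spheres *)

Section Tangency.
Local Open Scope ring_scope.
Variables (R : realType) (d : nat).
Implicit Types (p u v : 'rV[R]_d) (r s : R).

Lemma edist_eq u v r : 0 <= r ->
  (edist u v = r) <-> (\sum_(i < d) (u 0 i - v 0 i) ^+ 2 = r ^+ 2).
Proof.
move=> r0; have S0 : 0 <= \sum_(i < d) (u 0 i - v 0 i) ^+ 2.
  by apply: sumr_ge0 => i _; apply: sqr_ge0.
rewrite /edist; split=> [<-|->]; first by rewrite sqr_sqrtr.
by rewrite sqrtr_sqr ger0_norm.
Qed.

Lemma coord_edist u v i : `|u 0 i - v 0 i| <= edist u v.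
Proof.
rewrite /edist -sqrtr_sqr ler_wsqrtr // (bigD1 i) //= lerDl.
by apply: sumr_ge0 => j _; apply: sqr_ge0.
Qed.

Lemma balls_disjoint u v r s i : r + s <= `|u 0 i - v 0 i| ->
  (einterior u r `&` einterior v s = set0)%classic.
Proof.
move=> uv; rewrite -subset0 => p [/= pu pv].
have := le_lt_trans (coord_edist p u i) pu.
have := le_lt_trans (coord_edist p v i) pv; move: uv.
rewrite !ltr_norml => uv /andP[? ?] /andP[? ?]; have : `|u 0 i - v 0 i| < r + s.
  by rewrite ltr_norml; apply/andP; split; lra.
by rewrite ltNge uv.
Qed.

(* For a point [p] on both spheres, the left-hand side measures how far [p] is
   from dividing the segment between the centres in the ratio [r : s]. *)
Lemma tangency_defect p u v r s :
  \sum_(i < d) (p 0 i - u 0 i) ^+ 2 = r ^+ 2 ->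
  \sum_(i < d) (p 0 i - v 0 i) ^+ 2 = s ^+ 2 ->
  \sum_(i < d) (s * (p 0 i - u 0 i) + r * (p 0 i - v 0 i)) ^+ 2 =
  r * s * ((r + s) ^+ 2 - \sum_(i < d) (u 0 i - v 0 i) ^+ 2).
Proof.
move=> pu pv; set D := \sum_(i < d) (u 0 i - v 0 i) ^+ 2.
transitivity ((s ^+ 2 + r * s) * r ^+ 2 + (r ^+ 2 + r * s) * s ^+ 2 - r * s * D).
  rewrite -{1}pu -{2}pv /D !mulr_sumr -big_split -sumrB /=.
  by apply: eq_bigr => i _; ring.
by ring.
Qed.

(** The defect is a sum of squares, so a common point bounds the squared distance of the centres by
    [(r + s) ^+ 2]; the separation in coordinate [i] gives the reverse inequality. At equality the
    defect vanishes, which makes the common point unique. *)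
Lemma tangentP u v r s i : 0 < r -> 0 < s -> r + s <= `|u 0 i - v 0 i| ->
  tangent u r v s <-> \sum_(i < d) (u 0 i - v 0 i) ^+ 2 = (r + s) ^+ 2.
Proof.
move=> r0 s0 uv; have rs0 : 0 < r + s by lra.
have sphereP p : (esphere u r p /\ esphere v s p) <->
    (\sum_(i < d) (p 0 i - u 0 i) ^+ 2 = r ^+ 2 /\
     \sum_(i < d) (p 0 i - v 0 i) ^+ 2 = s ^+ 2).
  have Eu := edist_eq p u (ltW r0); have Ev := edist_eq p v (ltW s0).
  by split=> -[H1 H2]; split; [exact: Eu.1 H1|exact: Ev.1 H2|exact: Eu.2 H1|exact: Ev.2 H2].
split=> [[p [/sphereP[pu pv] _]]|uvE].
  apply/eqP; rewrite eq_le; apply/andP; split.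
    rewrite -subr_ge0 -(pmulr_rge0 _ (mulr_gt0 r0 s0)) -(tangency_defect pu pv).
    by apply: sumr_ge0 => j _; apply: sqr_ge0.
  apply: (@le_trans _ _ (`|u 0 i - v 0 i| ^+ 2)).
    by rewrite ler_pXn2r // nnegrE ltW.
  rewrite real_normK ?num_real // (bigD1 i) //= lerDl.
  by apply: sumr_ge0 => j _; apply: sqr_ge0.
(* The contact point divides the segment of centres in the ratio [r : s]. *)
exists (\row_j (u 0 j + r / (r + s) * (v 0 j - u 0 j))); split.
  apply/sphereP; split.
    transitivity (\sum_(j < d) (r / (r + s)) ^+ 2 * (u 0 j - v 0 j) ^+ 2).
      by apply: eq_bigr => j _; rewrite mxE; ring.
    by rewrite -mulr_sumr uvE; field; lra.
  transitivity (\sum_(j < d) (s / (r + s)) ^+ 2 * (u 0 j - v 0 j) ^+ 2).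
    by apply: eq_bigr => j _; rewrite mxE; field; lra.
  by rewrite -mulr_sumr uvE; field; lra.
move=> p /sphereP[pu pv]; apply/rowP => j; rewrite mxE.
have := tangency_defect pu pv; rewrite uvE subrr mulr0 => /psumr_eq0P def.
have : (s * (p 0 j - u 0 j) + r * (p 0 j - v 0 j)) ^+ 2 = 0.
  by apply: def => // k _; apply: sqr_ge0.
move/eqP; rewrite sqrf_eq0 => /eqP E; apply: (mulfI (lt0r_neq0 rs0)).
have : (r + s) * p 0 j = s * u 0 j + r * v 0 j by move: E; lra.
by move=> ->; field; lra.
Qed.

End Tangency.

(** * Iterated substitution of cubes *)

Section Words.
Variables (e b L : nat).
Hypotheses (b_odd : odd b) (L_odd : odd L) (L_gt2 : 2 < L).
Local Notation d := e.+3.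
Local Notation H := (b * L).

Definition fine (f : {ffun 'I_d -> 'I_H.+1}) :=
  [forall t, (t != ord0) ==> (b <= f t < H - b)].

Definition admissible (f : {ffun 'I_d -> 'I_H.+1}) :=
  [forall t, f t < H] && (fine f || [forall t, b %| f t]).

(* A piece of the subdivided cube, given by its lower corner: a unit cube in the
   lateral interior, or a cube of side [b] on the lateral boundary. *)
Definition tile := {f : {ffun 'I_d -> 'I_H.+1} | admissible f}.
HB.instance Definition _ := Finite.on tile.

Definition tpos (x : tile) (t : 'I_d) : nat := val x t.
(** A corner that is [fine] and also on the coarse grid counts as a unit cube, so the corner alone
    determines the tile. *)
Definition tside (x : tile) : nat := if fine (val x) then 1 else b.

(* A word of length [n] is a cube of the [n]-fold subdivision of [0, H ^ n]^d,
   the first letter being the coarsest level. *)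
Fixpoint wside (w : seq tile) : nat :=
  if w is x :: u then tside x * wside u else 1.

Fixpoint wpos (w : seq tile) (t : 'I_d) : nat :=
  if w is x :: u then H ^ size u * tpos x t + tside x * wpos u t else 0.

Lemma b_gt0 : 0 < b. Proof. exact: odd_gt0. Qed.
Lemma H_gt0 : 0 < H. Proof. by rewrite muln_gt0 b_gt0; lia. Qed.
#[local] Hint Resolve b_gt0 H_gt0 : core.

Lemma tside_gt0 x : 0 < tside x. Proof. by rewrite /tside; case: ifP. Qed.
Lemma tside_le x : tside x <= b. Proof. by rewrite /tside; case: ifP. Qed.

Lemma wside_gt0 w : 0 < wside w.
Proof. by elim: w => //= x w IH; rewrite muln_gt0 tside_gt0. Qed.
Lemma wside_le w : wside w <= b ^ size w.
Proof. by elim: w => //= x w IH; rewrite expnS leq_mul ?tside_le. Qed.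

Variant tile_spec (x : tile) : nat -> Prop :=
| TileFine of (forall t, t != ord0 -> b <= tpos x t /\ tpos x t + b < H)
              & (forall t, tpos x t < H) : tile_spec x 1
| TileCoarse of ~~ fine (val x) & (forall t, b %| tpos x t)
              & (forall t, tpos x t < H)
              & (exists2 t, t != ord0 & tpos x t = 0 \/ tpos x t + b = H) :
              tile_spec x b.

(** A multiple of [b] below [H] that violates [fine] in a lateral direction can only be [0] or
    [H - b]; hence a coarse tile touches a lateral face. *)
Lemma tileP x : tile_spec x (tside x).
Proof.
have /andP[/forallP lt_xH fx] := valP x; rewrite /tside.
case: ifP fx => /= [fx _|fx /forallP dx].
  constructor=> // t t0; have /implyP/(_ t0)/andP[] := forallP fx t.
  by rewrite /tpos ltn_subRL addnC.
constructor=> //; first by rewrite fx.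
have /forallPn[t] := negbT fx; rewrite negb_imply => /andP[t0 nt].
exists t => //; have := dvdn_leq _ (dx t); have := lt_xH t; rewrite /tpos.
move: (dx t) nt; move: (val x t : nat) => k /dvdnP[i ->] nt lt_iH _.
have [->|i_gt0] := posnP i; first by left.
right; have lt_iL : i < L by move: lt_iH; rewrite mulnC ltn_pmul2l.
have := b_gt0; nia.
Qed.

Lemma tpos_bound x t : tpos x t + tside x <= H.
Proof.
case: tileP => [_ /(_ t)|_ dx lx _]; first by lia.
have := lx t; have /dvdnP[i ->] := dx t.
by rewrite [H]mulnC addnC -mulSn ltn_pmul2r // leq_pmul2r.
Qed.

Lemma wpos_bound w t : wpos w t + wside w <= H ^ size w.
Proof.
elim: w => //= x w IH; rewrite expnS -addnA -mulnDr.
apply: (@leq_trans (H ^ size w * (tpos x t + tside x))).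
  by rewrite [leqRHS]mulnDr leq_add2l [H ^ _ * _]mulnC leq_mul2l IH orbT.
by rewrite mulnC leq_mul2r tpos_bound orbT.
Qed.

(** * Separation of cubes of one generation *)

Definition separated (x y : tile) t := tpos x t + tside x <= tpos y t.

(** Tiles of the same kind lie on a common grid; a fine and a coarse tile are separated in the
    direction in which the coarse one touches a lateral face. The second alternative describes tiles
    of one vertical column. *)
Lemma tile_sep x y : x != y ->
  (exists2 t, t != ord0 & separated x y t \/ separated y x t) \/
  [/\ forall t, t != ord0 -> tpos x t = tpos y t, tside x = tside y &
     separated x y ord0 \/ separated y x ord0].
Proof.
move=> xy; have : exists t, tpos x t != tpos y t.
  case: (pickP (fun t => tpos x t != tpos y t)) => [t|same]; first by exists t.
  case/eqP: xy; apply/val_inj/ffunP => t; apply/val_inj/eqP.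
  by have /negbT := same t; rewrite negbK.
have mult u v : b %| u -> b %| v -> u != v -> u + b <= v \/ v + b <= u.
  move=> /dvdnP[i ->] /dvdnP[j ->] ij.
  have : i != j by apply: contra ij => /eqP->.
  by rewrite neq_ltn => /orP[] ?; [left|right]; rewrite addnC -mulSn leq_mul2r; lia.
rewrite /separated; case: (tileP x) => [fx _|_ dx _ [s s0 xs]];
  case: (tileP y) => [fy _|_ dy _ [s' s'0 ys']] => -[t xyt].
- have [t0|t0] := eqVneq t ord0; last by left; exists t => //; lia.
  have [/existsP[t' /andP[t'0 ?]]|same] :=
    boolP [exists t', (t' != ord0) && (tpos x t' != tpos y t')].
    by left; exists t' => //; lia.
  right; split=> // [t' t'0|]; last by move: xyt; rewrite t0; lia.
  move/existsPn: same => /(_ t'); rewrite t'0 /= => /negPn/eqP; exact.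
- by left; exists s' => //; have [] := fx s' s'0; lia.
- by left; exists s => //; have [] := fy s s0; lia.
- have [t0|t0] := eqVneq t ord0; last by left; exists t => //; exact: mult.
  have [/existsP[t' /andP[t'0 ?]]|same] :=
    boolP [exists t', (t' != ord0) && (tpos x t' != tpos y t')].
    by left; exists t' => //; exact: mult.
  right; split=> // [t' t'0|]; last by move: xyt; rewrite t0; exact: mult.
  move/existsPn: same => /(_ t'); rewrite t'0 /= => /negPn/eqP; exact.
Qed.

(** The tiles at the first differing letter are separated, and the remaining letters stay inside
    these tiles. *)
Lemma word_sep w w' : size w = size w' -> w != w' ->
  exists t, wpos w t + wside w <= wpos w' t \/ wpos w' t + wside w' <= wpos w t.
Proof.
elim: w w' => [|x u IH] [|y v] //= [szuv]; rewrite eqseq_cons negb_and.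
have step (x1 y1 : tile) u1 v1 t : size u1 = size v1 -> separated x1 y1 t ->
    H ^ size u1 * tpos x1 t + tside x1 * wpos u1 t + tside x1 * wside u1 <=
    H ^ size v1 * tpos y1 t + tside y1 * wpos v1 t.
  move=> <- sep; rewrite -addnA -mulnDr.
  apply: leq_trans (leq_addr _ _); apply: leq_trans (leq_mul (leqnn _) sep).
  by rewrite [leqRHS]mulnDr leq_add2l [leqRHS]mulnC leq_mul2l wpos_bound orbT.
have [-> /= uv|xy _] := eqVneq x y.
  have [t Ht] := IH _ szuv uv; exists t; rewrite szuv -!addnA !leq_add2l -!mulnDr.
  by rewrite !leq_pmul2l ?tside_gt0.
have [[t _ [] sep]|[_ _ [] sep]] := tile_sep xy.
- by exists t; left; apply: step.
- by exists t; right; apply: step.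
- by exists ord0; left; apply: step.
- by exists ord0; right; apply: step.
Qed.

Lemma expn_bH m : b ^ m <= H ^ m.
Proof. by case: m => [|m] //; rewrite leq_exp2r // leq_pmulr //; lia. Qed.

(* A cube of the subdivision either belongs to the regular grid carried by the
   lateral boundary, or stays at least one mesh away from that boundary. *)
Lemma margin u : wside u = b ^ size u \/
  forall t, t != ord0 -> b ^ size u <= wpos u t /\
                         wpos u t + wside u + b ^ size u <= H ^ size u.
Proof.
elim: u => [|x v IH] /=; first by left.
have posv := wpos_bound v; have posx := tpos_bound x.
have := expn_bH (size v); rewrite !expnS.
case: tileP posx => [fx _|_ _ _ _] posx ble.
  right=> t /fx[]; have := posv t; rewrite mul1n.
  move: (b * L) (b ^ _) ((b * L) ^ _) ble (wpos v t) (wside v) (tpos x t).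
  move=> G B A BA P S T PS bT TG; split.
    by rewrite mulnC; apply: leq_trans (leq_addr _ _); apply: leq_mul.
  apply: (@leq_trans (A * (T + 1 + b))); last by rewrite mulnC leq_mul2r; lia.
  rewrite !mulnDr; have := leq_mul BA (leqnn b); lia.
case: IH => [->|IH]; [by left|right=> t /IH[]].
have := posx t; rewrite -/(b * L).
move: (b * L) (b ^ _) ((b * L) ^ _) ble (wpos v t) (wside v) (tpos x t).
move=> G B A BA P S T TG BP PSB; split.
  by apply: leq_trans (leq_addl _ _); rewrite leq_mul2l BP orbT.
apply: (@leq_trans (A * (T + b))); last by rewrite mulnC leq_mul2r TG orbT.
by rewrite -!addnA mulnDr leq_add2l -!mulnDr addnA mulnC leq_mul.
Qed.

(** At the first letters that differ laterally, either both remainders have the side of the boundary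
    grid, and then the sides differ by a factor at most [b], or one of them keeps the distance given
    by [margin], which becomes the gap. *)
Lemma word_gap w w' : size w = size w' ->
  (wside w <= b * wside w' /\ wside w' <= b * wside w) \/
  exists t G, [/\ t != ord0, wside w <= b * G &
    wpos w t + wside w + G <= wpos w' t \/
    wpos w' t + wside w' + G <= wpos w t].
Proof.
elim: w w' => [|x u IH] [|y v] //=; first by left; rewrite muln1.
move=> [szuv].
have [[same sxy]|[t t0 sep]] : ((forall t, t != ord0 -> tpos x t = tpos y t)
    /\ tside x = tside y) \/
    (exists2 t, t != ord0 & separated x y t \/ separated y x t).
  have [->|/tile_sep[|[]]] := eqVneq x y; by [left|right|left].
  have [[uv vu]|[t [G [t0 uG gap]]]] := IH _ szuv.
    by left; rewrite sxy !(mulnCA b) !leq_mul2l uv vu !orbT.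
  right; exists t, (tside y * G); split=> //.
    by rewrite sxy mulnCA leq_mul2l uG orbT.
  rewrite same // sxy szuv -!addnA !leq_add2l -!mulnDr.
  by rewrite !leq_pmul2l ?tside_gt0 ?addnA.
(* The candidate gap is the room left beyond [u] in its tile plus the room before [v], or the same
   with the roles exchanged. *)
have [[uE vE]|far] : (wside u = b ^ size u /\ wside v = b ^ size v) \/
    (tside x * wside u <= b * (tside x * (H ^ size u - wpos u t - wside u)
      + tside y * wpos v t) /\
     tside x * wside u <= b * (tside y * (H ^ size v - wpos v t - wside v)
      + tside x * wpos u t)).
- have xy : tside x <= b * tside y.
    by apply: leq_trans (tside_le x) _; rewrite leq_pmulr ?tside_gt0.
  have := wside_le u; have [->|/(_ t t0)[]] := margin u; last first.
    move=> ? ? ?; right; split; rewrite mulnDr.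
      apply: leq_trans (leq_addr _ _); apply: leq_trans (leq_pmull _ b_gt0).
      by rewrite leq_mul2l; apply/orP; right; lia.
    apply: leq_trans (leq_addl _ _); apply: leq_trans (leq_pmull _ b_gt0).
    by rewrite leq_mul2l; apply/orP; right; lia.
  have [->|/(_ t t0)[]] := margin v; first by left.
  rewrite -szuv => ? ? _; right; split; rewrite mulnDr !mulnA.
    by apply: leq_trans (leq_addl _ _); apply: leq_mul => //; lia.
  by apply: leq_trans (leq_addr _ _); apply: leq_mul => //; lia.
- left; rewrite uE vE szuv !mulnA !leq_mul2r.
  have := tside_gt0 x; have := tside_gt0 y; have := tside_le x; have := tside_le y.
  have := b_gt0; split; apply/orP; right; nia.
have step (x1 y1 : tile) u1 v1 : size u1 = size v1 -> separated x1 y1 t ->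
    H ^ size u1 * tpos x1 t + tside x1 * wpos u1 t + tside x1 * wside u1 +
    (tside x1 * (H ^ size u1 - wpos u1 t - wside u1) + tside y1 * wpos v1 t) <=
    H ^ size v1 * tpos y1 t + tside y1 * wpos v1 t.
  move=> <- szuv1; rewrite addnA leq_add2r -!addnA -!mulnDr.
  rewrite [X in tside x1 * X]addnA -subnDA subnKC ?wpos_bound //.
  by rewrite (mulnC (tside x1)) -mulnDr; apply: leq_mul.
right; exists t; case: sep far => sep [far1 far2].
- by eexists; split; [|exact: far1|left; exact: step].
- by eexists; split; [|exact: far2|right; exact: step].
Qed.

(* Twice the coordinates of the centre, so that they are integers. *)
Definition wcen w t := (wpos w t).*2 + wside w.

(** Centres are doubled, so the side of a cube stands for the doubled radius of its inscribed ball: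
    the equation is the tangency of the two balls. *)
Definition wadj (w w' : seq tile) := [&& size w == size w', w != w' &
  (\sum_t ((wcen w t)%:Z - (wcen w' t)%:Z) ^+ 2 ==
   ((wside w + wside w')%:Z) ^+ 2)%R].

Lemma wadj_sym : symmetric wadj.
Proof.
move=> w w'; rewrite /wadj eq_sym (eq_sym w) addnC.
by under eq_bigr do rewrite -sqrrN opprB.
Qed.

Lemma wadj_size w w' : wadj w w' -> size w = size w'.
Proof. by case/and3P=> /eqP. Qed.

Lemma wadj_cen w w' t : wadj w w' -> wcen w t <= wcen w' t + wside w + wside w'.
Proof.
case/and3P=> _ _ /eqP; rewrite (bigD1 t) //= => sumE.
have : (((wcen w t)%:Z - (wcen w' t)%:Z) ^+ 2 <= ((wside w + wside w')%:Z) ^+ 2)%R.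
  by rewrite -sumE lerDl sumr_ge0 // => i _; apply: sqr_ge0.
by rewrite -addnA !expr2; move: (wcen w t) (wcen w' t) (wside w + wside w')%N => x y z; nia.
Qed.

Lemma wadj_ratio w w' : wadj w w' -> wside w <= b * wside w'.
Proof.
move=> ww'; have [[]//|[t [G [_ wG gap]]]] := word_gap (wadj_size ww').
have := wadj_cen t ww'; have w'w := ww'; rewrite wadj_sym in w'w.
have := wadj_cen t w'w; have G0 : 0 < G.
  by have := wside_gt0 w; case: (G) wG => //; rewrite muln0; lia.
by rewrite /wcen; move: gap G0 {wG}; lia.
Qed.

(** The centres differ only in direction [s], so the balls touch at the centres of the facing faces.
    Every contact constructed below is of this kind. *)
Lemma wadj_contact w w' s : size w = size w' ->
  wpos w s + wside w = wpos w' s -> (forall t, t != s -> wcen w t = wcen w' t) ->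
  wadj w w'.
Proof.
move=> szw ws wt; rewrite /wadj szw eqxx /=; apply/andP; split.
  by apply/eqP => ww'; move: ws; rewrite ww'; have := wside_gt0 w'; lia.
rewrite (bigD1 s) //= big1 ?addr0 => [|t /wt->]; last by rewrite subrr expr0n.
by rewrite -sqrrN; apply/eqP; congr (_ ^+ 2)%R; rewrite /wcen; lia.
Qed.

(** * Concatenation of words and short paths *)

Lemma wside_cat p u : wside (p ++ u) = wside p * wside u.
Proof. by elim: p => [|x p IH] /=; rewrite ?mul1n // IH mulnA. Qed.

Lemma wpos_cat p u t :
  wpos (p ++ u) t = H ^ size u * wpos p t + wside p * wpos u t.
Proof.
elim: p => [|x p IH] /=; first by rewrite muln0 mul1n.
by rewrite IH size_cat expnD mulnDr !addnA !mulnDr !mulnA [H ^ size u * _]mulnC (mulnC (tside x) (H ^ _)).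
Qed.

Lemma wcen_cat p u t :
  wcen (p ++ u) t = (H ^ size u * wpos p t).*2 + wside p * wcen u t.
Proof. by rewrite /wcen wpos_cat wside_cat doubleD mulnDr -doubleMr addnA. Qed.

Lemma wadj_cat p u u' : wadj u u' -> wadj (p ++ u) (p ++ u').
Proof.
case/and3P=> szu uu' /eqP sumE; rewrite /wadj !size_cat eqn_add2l szu.
rewrite eqseq_cat // eqxx uu' /= !wside_cat -mulnDr PoszM exprMn -sumE mulr_sumr.
apply/eqP/eq_bigr => t _; rewrite -exprMn; congr (_ ^+ 2)%R.
by rewrite !wcen_cat (eqP szu) !PoszD !PoszM opprD addrACA subrr add0r mulrBr.
Qed.

(** Distances are bounded on words first, since an [sgraph] presupposes the connectedness that these
    bounds provide. *)
Definition near k w w' :=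
  exists s, [/\ path wadj w s, last w s = w' & size s <= k].

Lemma near_refl w : near 0 w w. Proof. by exists [::]. Qed.

Lemma near_adj w w' : wadj w w' -> near 1 w w'.
Proof. by exists [:: w']; rewrite /= andbT. Qed.

Lemma near_le k k' w w' : k <= k' -> near k w w' -> near k' w w'.
Proof. by move=> kk' [s [? ? sk]]; exists s; split=> //; apply: leq_trans kk'. Qed.

Lemma near_trans k k' w2 w1 w3 :
  near k w1 w2 -> near k' w2 w3 -> near (k + k') w1 w3.
Proof.
move=> [s [ps ls sk]] [s' [ps' ls' sk']]; exists (s ++ s').
by rewrite cat_path last_cat size_cat ls ps ps' leq_add.
Qed.

Lemma near_sym k w w' : near k w w' -> near k w' w.
Proof.
move=> [s [ps <- sk]]; exists (rev (belast w s)).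
rewrite rev_path size_rev size_belast; split=> //; last first.
  by case: s {ps sk} => //= x s; rewrite rev_cons last_rcons.
by rewrite (eq_path (e' := wadj)) // => x y; rewrite wadj_sym.
Qed.

Lemma near_cat p k u u' : near k u u' -> near k (p ++ u) (p ++ u').
Proof.
move=> [s [ps <- sk]]; exists (map (cat p) s); rewrite size_map last_map.
split=> //; elim: s u ps {sk} => //= x s IH u /andP[ux xs].
by rewrite wadj_cat //= IH.
Qed.

(** * The lateral boundary grid, hubs, and the diameter bound *)

Lemma tile0_subproof : admissible [ffun=> ord0].
Proof.
apply/andP; split; first by apply/forallP=> t; rewrite ffunE H_gt0.
by apply/orP; right; apply/forallP=> t; rewrite ffunE dvdn0.
Qed.

Definition mkt (f : 'I_d -> nat) : tile :=
  insubd (Sub _ tile0_subproof : tile) [ffun t => inord (f t)].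

Lemma eq_mkt f g : f =1 g -> mkt f = mkt g.
Proof. by move=> fg; congr insubd; apply/ffunP=> t; rewrite !ffunE fg. Qed.

Lemma mkt_coarse f (s : 'I_d) : (forall t, f t < H) -> (forall t, b %| f t) ->
  s != ord0 -> f s = 0 \/ f s + b = H ->
  (forall t, tpos (mkt f) t = f t) /\ ~~ fine (val (mkt f)).
Proof.
move=> fH bf s0 fs; set g := [ffun t => inord (f t)] : {ffun 'I_d -> 'I_H.+1}.
have gE t : g t = f t :> nat by rewrite ffunE inordK // ltnS ltnW.
have ag : admissible g.
  by rewrite /admissible; apply/andP; split; [|apply/orP; right];
     apply/forallP=> t; rewrite gE.
rewrite /tpos /mkt !val_insubd ag; split=> //; apply/negP => /forallP/(_ s).
by rewrite s0 gE /= ltn_subRL => /andP[]; have := b_gt0; case: fs; lia.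
Qed.

Lemma mkt_fine f : (forall t, f t < H) ->
  (forall t, t != ord0 -> b <= f t /\ f t + b < H) ->
  (forall t, tpos (mkt f) t = f t) /\ fine (val (mkt f)).
Proof.
move=> fH bf; set g := [ffun t => inord (f t)] : {ffun 'I_d -> 'I_H.+1}.
have gE t : g t = f t :> nat by rewrite ffunE inordK // ltnS ltnW.
have fg : fine g.
  by apply/forallP=> t; apply/implyP => /bf[]; rewrite gE ltn_subRL addnC => -> ->.
have ag : admissible g.
  by rewrite /admissible fg andbT; apply/forallP=> t; rewrite gE.
by rewrite /tpos /mkt !val_insubd ag fg.
Qed.

Lemma tposK x : mkt (tpos x) = x.
Proof.
rewrite /mkt; have -> : [ffun t => inord (tpos x t)] = val x.
  by apply/ffunP=> t; rewrite ffunE inord_val.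
by rewrite valKd.
Qed.

Lemma tpos_inj x y : tpos x =1 tpos y -> x = y.
Proof. by move=> xy; rewrite -(tposK x) -(tposK y); apply: eq_mkt. Qed.

(* The word of the grid cube at position [k], by base-[L] digits; meaningful
   only when that cube touches the lateral boundary (see [poswP]). *)
Fixpoint posw m (k : 'I_d -> nat) : seq tile :=
  if m is m'.+1 then
    mkt (fun t => b * (k t %/ L ^ m')) :: posw m' (fun t => k t %% L ^ m')
  else [::].

Lemma eq_posw m k k' : k =1 k' -> posw m k = posw m k'.
Proof.
elim: m k k' => //= m IH k k' kk'; congr cons.
  by apply: eq_mkt => t; rewrite kk'.
by apply: IH => t; rewrite kk'.
Qed.

Lemma expL_gt0 m : 0 < L ^ m. Proof. by rewrite expn_gt0; lia. Qed.

(** When the cube touches a lateral face in direction [s], the base-[L] digits of [k s] are all [0]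
    or all [L - 1]. Thus every letter is a coarse tile. *)
Lemma poswP m k s : (forall t, k t < L ^ m) ->
  s != ord0 -> k s = 0 \/ (k s).+1 = L ^ m ->
  [/\ size (posw m k) = m, wside (posw m k) = b ^ m &
      forall t, wpos (posw m k) t = b ^ m * k t].
Proof.
move=> + s0; elim: m k => [|m IH] k kL ks /=.
  by split=> // t; have := kL t; rewrite expn0; lia.
have A0 := expL_gt0 m; set f := fun t => b * _.
have [fE /negbTE nf] : (forall t, tpos (mkt f) t = f t) /\ ~~ fine (val (mkt f)).
  apply: (@mkt_coarse f s) => // [t|t|]; rewrite /f /= ?dvdn_mulr //.
    by rewrite ltn_pmul2l // ltn_divLR // -expnS.
  case: ks => [->|ksE]; first by left; rewrite div0n muln0.
  right; have -> : k s = L.-1 * L ^ m + (L ^ m).-1.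
    by move: ksE; rewrite expnS -(ltn_predK L_gt2) mulSn /=; lia.
  by rewrite divnMDl // divn_small ?prednK // addn0 -mulnSr prednK //; lia.
have [t||szE sE pE] := IH (fun t => k t %% L ^ m); first by rewrite ltn_mod.
  case: ks => [->|ksE]; first by left; rewrite mod0n.
  right; have -> : k s = L.-1 * L ^ m + (L ^ m).-1.
    by move: ksE; rewrite expnS -(ltn_predK L_gt2) mulSn /=; lia.
  by rewrite modnMDl modn_small prednK.
rewrite szE sE /tside nf expnS; split=> // t; rewrite fE pE /f /= [in RHS](divn_eq (k t) (L ^ m)).
by rewrite expnMn; ring.
Qed.

Definition upd (k : 'I_d -> nat) s i := fun t => if t == s then i else k t.

(** The coordinate [s'] stays on a lateral face, so every intermediate position is a cube of the
    boundary grid, and consecutive ones share a face. *)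
Lemma near_line m k s s' i j : (forall t, k t < L ^ m) ->
  s' != s -> s' != ord0 -> k s' = 0 \/ (k s').+1 = L ^ m -> i <= j < L ^ m ->
  near (j - i) (posw m (upd k s i)) (posw m (upd k s j)).
Proof.
move=> kL ss' s0 ks'; elim: j => [|j IH]; first by case: i => //= _; apply: near_refl.
rewrite leq_eqVlt => /andP[/orP[/eqP->|ij] jL]; first by rewrite subnn; apply: near_refl.
have ukL l : l < L ^ m -> forall t, upd k s l t < L ^ m by rewrite /upd => ? t; case: ifP.
have us' l : upd k s l s' = k s' by rewrite /upd (negbTE ss').
rewrite subSn // -addn1; apply: near_trans (IH _) (near_adj _); first by lia.
have [||sz1 s1 p1] := @poswP m (upd k s j) s' _ s0; rewrite ?us' //.
  by apply: ukL; lia.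
have [||sz2 s2 p2] := @poswP m (upd k s j.+1) s' _ s0; rewrite ?us' //.
  by apply: ukL; lia.
apply: (@wadj_contact _ _ s); rewrite ?sz1 // ?s1 ?p1 ?p2.
  by rewrite /upd eqxx mulnSr.
by move=> t /negbTE ts; rewrite /wcen s1 s2 p1 p2 /upd ts.
Qed.

Definition dx : 'I_d := @Ordinal d 1 isT.
Definition dz : 'I_d := @Ordinal d 2 isT.

(* [hub m] is the cube at the centre of the face [dx = 0].  Since [b] and [L] are
   odd, hubs of adjacent pieces of different sizes are aligned with each other;
   this is the only contact used between coarse and fine pieces. *)
Definition hubt := mkt (fun t => if t == dx then 0 else b * L./2).
Definition hub m := nseq m hubt.
Definition khub m : 'I_d -> nat := fun t => if t == dx then 0 else (L ^ m)./2.

Lemma halfL m : L ^ m = ((L ^ m)./2).*2.+1.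
Proof. by rewrite -[LHS]odd_double_half oddX L_odd orbT. Qed.

(** As [L] is odd, all base-[L] digits of [(L ^ m)./2] equal [L./2]. *)
Lemma hubE m : hub m = posw m (khub m).
Proof.
rewrite /hub; elim: m => //= m ->; have A0 := expL_gt0 m.
have LE : (L ^ m.+1)./2 = L./2 * L ^ m + (L ^ m)./2.
  apply: double_inj; apply: succn_inj; rewrite -halfL expnS {1}(halfL m).
  have LE := odd_double_half L; rewrite L_odd in LE.
  by rewrite -[X in X * _]LE -!muln2; have := halfL m; nia.
have lt2 : (L ^ m)./2 < L ^ m by rewrite {2}(halfL m); lia.
congr cons.
  apply: eq_mkt => t; rewrite /khub; case: eqP => _; first by rewrite div0n muln0.
  by rewrite LE divnMDl // divn_small // addn0.
apply: eq_posw => t; rewrite /khub; case: eqP => _; first by rewrite mod0n.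
by rewrite LE modnMDl modn_small.
Qed.

Lemma half_ltL m : (L ^ m)./2 < L ^ m.
Proof. by rewrite {2}halfL; lia. Qed.

Lemma khub_lt m t : khub m t < L ^ m.
Proof. by rewrite /khub; case: ifP; rewrite ?expL_gt0 ?half_ltL. Qed.

Lemma near_line_le m k s s' i j : (forall t, k t < L ^ m) ->
  s' != s -> s' != ord0 -> k s' = 0 \/ (k s').+1 = L ^ m ->
  i < L ^ m -> j < L ^ m ->
  near (maxn i j) (posw m (upd k s i)) (posw m (upd k s j)).
Proof.
move=> kL ss' s0 ks' iL jL; have [ij|ji] := leqP i j.
  by apply: near_le (near_line kL ss' s0 ks' _); rewrite ?leq_subr ?ij.
apply: near_sym; apply: near_le (near_line kL ss' s0 ks' _); rewrite ?leq_subr //.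
by rewrite ltnW.
Qed.

(* From one face centre to the opposite one around the block, along its lateral
   boundary: this needs a second lateral direction [dz], that is [d >= 3]. *)
Lemma near_antihub m : near (L ^ m).*2
  (hub m) (posw m (upd (khub m) dx (L ^ m).-1)).
Proof.
have A0 := expL_gt0 m; have ltp : (L ^ m).-1 < L ^ m by rewrite ltn_predL.
have := halfL m; have hlt := half_ltL m; set M := (L ^ m)./2 in hlt * => ML.
have kx : khub m dx = 0 by [].
have lt1 := @khub_lt m.
have lt2 t : upd (khub m) dz 0 t < L ^ m by rewrite /upd; case: ifP.
have lt3 t : upd (khub m) dx (L ^ m).-1 t < L ^ m by rewrite /upd; case: ifP.
have P1 := @near_line_le m _ dz dx M 0 lt1 isT isT (or_introl kx) hlt A0.
have P2 := @near_line_le m _ dx dz 0 (L ^ m).-1 lt2 isT isT (or_introl erefl) A0 ltp.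
have P3 := @near_line_le m _ dz dx 0 M lt3 isT isT (or_intror (prednK A0)) A0 hlt.
have E1 : upd (khub m) dz M =1 khub m.
  by move=> t; rewrite /upd; case: eqP => // ->.
have E2 : upd (upd (khub m) dz 0) dx 0 =1 upd (khub m) dz 0.
  by move=> t; rewrite {1}/upd; case: eqP => // ->.
have E3 : upd (upd (khub m) dx (L ^ m).-1) dz 0 =1
          upd (upd (khub m) dz 0) dx (L ^ m).-1.
  by move=> t; rewrite /upd; case: eqP => // ->.
have E4 : upd (upd (khub m) dx (L ^ m).-1) dz M =1 upd (khub m) dx (L ^ m).-1.
  by move=> t; rewrite {1}/upd; case: eqP => // ->.
rewrite hubE -(eq_posw m E1) -(eq_posw m E4).
rewrite (eq_posw m E3) in P3; rewrite (eq_posw m E2) in P2.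
apply: near_le (near_trans P1 (near_trans P2 P3)).
by rewrite !maxn0 !max0n; lia.
Qed.

(** If [s = dx], go from the hub of [x] to the centre of the opposite face, which touches the hub of
    [y] even when the sides differ. Otherwise walk along the face [dx = 0] from the hub of [x] to
    its edge, cross, and walk on to the hub of [y]. *)
Lemma near_step m x y s : tpos x s + tside x = tpos y s ->
  (forall t, t != s -> (tpos x t).*2 + tside x = (tpos y t).*2 + tside y) ->
  s = dx \/ tside x = tside y -> near (3 * L ^ m) (x :: hub m) (y :: hub m).
Proof.
move=> xys xyt side; have A0 := expL_gt0 m; have ML := halfL m.
have hlt := half_ltL m; have ltp : (L ^ m).-1 < L ^ m by rewrite ltn_predL.
have lt1 := @khub_lt m; have kx : khub m dx = 0 by [].
have [szh sh ph] := @poswP m _ dx lt1 isT (or_introl kx).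
have HE : H ^ m = b ^ m * L ^ m by rewrite expnMn.
have [sE|sdx] := eqVneq s dx.
  subst s; set a := posw m (upd (khub m) dx (L ^ m).-1).
  have [|//||sza sa pa] := @poswP m (upd (khub m) dx (L ^ m).-1) dx.
  - by move=> t; rewrite /upd; case: ifP.
  - by right; rewrite /upd eqxx prednK.
  apply: (@near_le ((L ^ m).*2 + 1)); first by lia.
  apply: near_trans (near_cat [:: x] (near_antihub m)) (near_adj _).
  rewrite -/a hubE; apply: (@wadj_contact _ _ dx) => /=; rewrite ?sza ?szh //.
    rewrite sa ph pa /upd eqxx kx !muln0 addn0 -xys mulnDr.
    by rewrite HE -addnA; congr (_ + _); rewrite -mulnDr -mulnSr prednK // mulnC.
  move=> t ts; have := xyt t ts; rewrite /wcen /= sza szh sa sh pa ph /upd (negbTE ts).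
  rewrite /khub (negbTE ts) HE; move: ML.
  move: (L ^ m) (L ^ m)./2 (b ^ m) => A M B -> E.
  have := congr1 (muln (B * M.*2.+1)) E; rewrite -!muln2; lia.
have {side} side : tside x = tside y by case: side => // sE; rewrite sE eqxx in sdx.
apply: (@near_le ((L ^ m).-1 + (1 + (L ^ m)./2))); first by lia.
have ds : dx != s by rewrite eq_sym.
have xyt' t : t != s -> tpos x t = tpos y t by move=> /xyt; rewrite side; lia.
have ks : khub m s = (L ^ m)./2 by rewrite /khub (negbTE sdx).
have E1 : upd (khub m) s (L ^ m)./2 =1 khub m.
  by move=> t; rewrite /upd; case: eqP => // ->.
have P1 := near_line_le lt1 ds isT (or_introl kx) hlt ltp.
have P2 := near_line_le lt1 ds isT (or_introl kx) A0 hlt.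
rewrite (eq_posw m E1) -hubE in P1 P2; rewrite max0n in P2.
apply: (@near_trans _ _ (x :: posw m (upd (khub m) s (L ^ m).-1))).
  by apply: near_le (near_cat [:: x] P1); rewrite geq_max leqnn andbT; lia.
apply: near_trans (near_adj _) (near_cat [:: y] P2).
have ukL i : i < L ^ m -> forall t, upd (khub m) s i t < L ^ m.
  by move=> ? t; rewrite /upd; case: ifP.
have ukx i : upd (khub m) s i dx = 0 by rewrite /upd (negbTE ds).
have [szu su pu] := @poswP m _ dx (ukL _ ltp) isT (or_introl (ukx _)).
have [szv sv pv] := @poswP m _ dx (ukL _ A0) isT (or_introl (ukx _)).
apply: (@wadj_contact _ _ s) => /=; rewrite ?szu ?szv //.
  rewrite su pu pv /upd eqxx !muln0 addn0 -xys mulnDr.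
  by rewrite HE -addnA; congr (_ + _); rewrite -mulnDr -mulnSr prednK // mulnC.
by move=> t ts; rewrite /wcen /= szu szv su sv pu pv /upd (negbTE ts) xyt' // side.
Qed.

(** Every move to a neighbouring tile lowers the sum of the coordinates, which is at most [d * H],
    and costs at most [3 * L ^ m] steps. *)
Lemma near_descent m (P : tile -> Prop) r :
  (forall x, P x -> x <> r -> exists y s,
     [/\ P y, tside y = tside x, tpos y s + tside y = tpos x s &
         forall t, t != s -> tpos y t = tpos x t]) ->
  forall x, P x -> near (3 * d * H * L ^ m) (x :: hub m) (r :: hub m).
Proof.
move=> dec x Px; apply: (@near_le ((\sum_t tpos x t) * (3 * L ^ m))).
  have SH : \sum_t tpos x t <= d * H.
    have -> : d * H = \sum_(t < d) H by rewrite sum_nat_const card_ord.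
    apply: leq_sum => t _.
    by have := tpos_bound x t; lia.
  by apply: leq_trans (leq_mul SH (leqnn _)) _; rewrite mulnCA !mulnA.
have [n leN] := ubnP (\sum_t tpos x t); elim: n x Px leN => // n IH x Px xn.
have [->|/eqP xr] := eqVneq x r; first exact: near_le (near_refl _).
have [y [s [Py yx ys yt]]] := dec x Px xr.
have ltyx : \sum_t tpos y t < \sum_t tpos x t.
  rewrite (bigD1 s) //= [ltnRHS](bigD1 s) //= (eq_bigr _ yt) ltn_add2r.
  by have := tside_gt0 y; lia.
have P1 : near (3 * L ^ m) (y :: hub m) (x :: hub m).
  by apply: (@near_step m y x s) => //; [move=> t /yt->; rewrite yx|right].
apply: (@near_le (3 * L ^ m + (\sum_t tpos y t) * (3 * L ^ m))).
  by rewrite -mulSn leq_mul2r ltyx orbT.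
by apply: near_trans (near_sym P1) (IH y Py _); lia.
Qed.

Lemma near_zero m x : ~~ fine (val x) ->
  near (3 * d * H * L ^ m) (x :: hub m) (mkt (fun=> 0) :: hub m).
Proof.
apply: (@near_descent m (fun x => ~~ fine (val x))) => {}x xf xr.
case: tileP (xf) => [fx _|_ bx xH [t t0 xt] _].
  by case/negP; apply/forallP=> t; apply/implyP=> /fx[]; rewrite ltn_subRL addnC => -> ->.
have [r0 xr0] : exists s, tpos x s != 0.
  case: (pickP (fun s => tpos x s != 0)) => [s|x0]; first by exists s.
  case: xr; rewrite -(tposK x); apply: eq_mkt => s; apply/eqP.
  by have /negbT := x0 s; rewrite negbK.
(* Lowering coordinate [s] must leave the tile on a lateral face, so another lateral direction [s']
   has to carry the contact. If [t] is the only nonzero coordinate, [dx] or [dz] serves. *)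
have [s [s' [xs s's s'0 xs']]] : exists s s',
    [/\ tpos x s != 0, s' != s, s' != ord0 & tpos x s' = 0 \/ tpos x s' + b = H].
  have [/existsP[s /andP[st xs]]|/existsPn x0] :=
    boolP [exists s, (s != t) && (tpos x s != 0)].
    by exists s, t; split=> //; rewrite eq_sym.
  have r0t : r0 = t by apply/eqP; have := x0 r0; rewrite xr0 andbT negbK.
  exists t, (if t == dx then dz else dx); split; first by rewrite -r0t.
  - by case: (eqVneq t dx) => [->|]; rewrite // eq_sym.
  - by case: ifP.
  - left; apply/eqP; have := x0 (if t == dx then dz else dx).
    rewrite negb_and !negbK => /orP[] //; case: (eqVneq t dx) => [->//|].
    by rewrite eq_sym => /negbTE->.
have bs : b <= tpos x s by apply: dvdn_leq; rewrite ?lt0n ?bx.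
have [||//||fE nfE] := @mkt_coarse (upd (tpos x) s (tpos x s - b)) s'.
- by move=> i; rewrite /upd; case: ifP => // _; have := xH s; lia.
- by move=> i; rewrite /upd; case: ifP => // _; rewrite dvdn_sub.
- by rewrite /upd (negbTE s's).
exists (mkt (upd (tpos x) s (tpos x s - b))), s; split => //.
- by rewrite /tside (negbTE nfE).
- by rewrite fE /tside (negbTE nfE) /upd eqxx subnK.
- by move=> i /negbTE iEs; rewrite fE /upd iEs.
Qed.

Lemma near_corner m x : fine (val x) ->
  near (3 * d * H * L ^ m) (x :: hub m)
    (mkt (fun t => if t == ord0 then 0 else b) :: hub m).
Proof.
apply: (@near_descent m (fun x => fine (val x))) => {}x xf xr.
have x1 : tside x = 1 by rewrite /tside xf.
have fx t : t != ord0 -> b <= tpos x t /\ tpos x t + b < H.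
  by move=> t0; have /implyP/(_ t0)/andP[] := forallP xf t; rewrite ltn_subRL addnC.
have xH t : tpos x t < H by have := tpos_bound x t; rewrite x1; lia.
have [s xs] : exists s, tpos x s != if s == ord0 then 0 else b.
  case: (pickP (fun s => tpos x s != if s == ord0 then 0 else b)) => [s|x0].
    by exists s.
  case: xr; rewrite -(tposK x); apply: eq_mkt => s; apply/eqP.
  by have /negbT := x0 s; rewrite negbK.
have xs0 : 0 < tpos x s.
  have [s0|/fx[bs _]] := eqVneq s ord0; last by have := b_gt0; lia.
  by move: xs; rewrite s0 eqxx lt0n.
have [||fE nfE] := @mkt_fine (upd (tpos x) s (tpos x s).-1).
- by move=> i; rewrite /upd; case: ifP => // _; have := xH s; lia.
- move=> i i0; rewrite /upd; case: eqP => [iEs|_]; last exact: fx.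
  by subst i; have [? ?] := fx s i0; move: xs; rewrite (negbTE i0); lia.
exists (mkt (upd (tpos x) s (tpos x s).-1)), s; split => //.
- by rewrite /tside nfE xf.
- by rewrite fE /tside nfE /upd eqxx addn1 prednK.
- by move=> i /negbTE iEs; rewrite fE /upd iEs.
Qed.

Lemma hubtE : (forall t, tpos hubt t = if t == dx then 0 else b * L./2) /\
  ~~ fine (val hubt).
Proof.
apply: (@mkt_coarse _ dx) => // [t|t|]; last by left.
  by case: eqP => // _; rewrite ltn_pmul2l //; lia.
by case: eqP; rewrite ?dvdn0 ?dvdn_mulr.
Qed.

Lemma near_hubt m x :
  near (9 * d * H * L ^ m + 3 * L ^ m) (x :: hub m) (hubt :: hub m).
Proof.
have [hE hf] := hubtE; have hz := near_sym (near_zero m hf).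
have [fx|fx] := boolP (fine (val x)); last first.
  by apply: near_le (near_trans (near_zero m fx) hz); lia.
have LE := odd_double_half L; rewrite L_odd in LE.
have bE := odd_double_half b; rewrite b_odd in bE.
(* [y] is the unit tile behind the centre of the inner face of [hubt]; the centres are aligned
   because [b] is odd. *)
pose y := mkt (fun t => if t == dx then b else b * L./2 + b./2).
have [||yE yf] := @mkt_fine (fun t => if t == dx then b else b * L./2 + b./2).
- move=> t; case: ifP => _; nia.
- move=> t _; case: ifP => _; nia.
have yh : near (3 * L ^ m) (hubt :: hub m) (y :: hub m).
  have sy : tside y = 1 by rewrite /tside yf.
  have sh : tside hubt = b by rewrite /tside (negbTE hf).
  apply: (@near_step m _ _ dx); [by rewrite hE yE eqxx sh| |by left].
  by move=> t /negbTE tx; rewrite hE yE tx sy sh -!muln2; nia.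
apply: near_le (near_trans (near_corner m fx)
  (near_trans (near_sym (near_corner m yf)) (near_sym yh))).
by lia.
Qed.

Definition reach := 9 * d * H + 3.

(** The costs form a geometric sum: [reach * L ^ m] for the tail and at most as much for the first
    letter add up to at most [reach * L ^ m.+1], since [L >= 2]. *)
Lemma near_hub w : near (reach * L ^ size w) w (hub (size w)).
Proof.
elim: w => [|x u IH] /=; first by apply: near_le (near_refl _).
apply: near_le (near_trans (near_cat [:: x] IH) (near_hubt (size u) x)).
by rewrite -mulnDl -/reach addnn -mul2n mulnCA expnS leq_mul2l leq_mul2r ltnW ?orbT.
Qed.

Definition spread := reach.*2.

Lemma near_all w w' : size w = size w' -> near (spread * L ^ size w) w w'.
Proof.
move=> ww'; have := near_sym (near_hub w'); rewrite -ww' => nw'.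
by apply: near_le (near_trans (near_hub w) nw'); rewrite addnn doubleMl.
Qed.

(** * The tangency graphs *)

Definition tadj n (x y : n.-tuple tile) := wadj x y.

Lemma tadj_sym n : symmetric (@tadj n).
Proof. by move=> x y; rewrite /tadj wadj_sym. Qed.

Lemma tadj_irr n : irreflexive (@tadj n).
Proof. by move=> x; apply/negP => /and3P[_]; rewrite eqxx. Qed.

Lemma tuples_gt0 n : 0 < #|{: n.-tuple tile}|.
Proof. by apply/card_gt0P; exists (nseq_tuple n hubt). Qed.

Lemma tuple_path n (x : n.-tuple tile) s : path wadj x s ->
  exists2 s' : seq (n.-tuple tile), map val s' = s & path (@tadj n) x s'.
Proof.
elim: s x => [|w s IH] x /=; first by exists [::].
case/andP=> xw ws; have szw : size w == n by rewrite -(wadj_size xw) size_tuple.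
have [s' <- ps'] := IH (Tuple szw) ws.
by exists (Tuple szw :: s') => //=; rewrite ps' andbT.
Qed.

Lemma near_tuple n k (x y : n.-tuple tile) : near k x y ->
  exists s, [/\ path (@tadj n) x s, last x s = y & size s <= k].
Proof.
move=> [s [/tuple_path[s' <- xs'] + sk]]; rewrite last_map => /val_inj ls.
by exists s'; split=> //; rewrite size_map in sk.
Qed.

Lemma tadj_connected n x y : connect (@tadj n) x y.
Proof.
have [|s [xs <- _]] := near_tuple (@near_all x y _); first by rewrite !size_tuple.
by apply/connectP; exists s.
Qed.

Definition tiling_graph n : sgraph :=
  SGraph (@tadj_sym n) (@tadj_irr n) (tuples_gt0 n) (@tadj_connected n).

Lemma val_path n (x : n.-tuple tile) s :
  path (@tadj n) x s -> path wadj (val x) (map val s).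
Proof. by elim: s x => //= y s IH x /andP[xy /IH->]; rewrite andbT. Qed.

Definition word n (x : tiling_graph n) : seq tile := tval x.

Lemma size_word n (x : tiling_graph n) : size (word x) = n.
Proof. exact: size_tuple. Qed.

Lemma word_inj n : injective (@word n).
Proof. exact: val_inj. Qed.

Lemma word_onto n w : size w = n -> exists x : tiling_graph n, word x = w.
Proof. by move/eqP=> szw; exists (Tuple szw). Qed.

Lemma gdist_near n k (x y : tiling_graph n) :
  near k (word x) (word y) -> gdist x y <= k.
Proof.
by move=> /near_tuple[s [xs <- sk]]; apply: leq_trans sk; apply: gdist_le.
Qed.

Lemma gdist_words n (x y : tiling_graph n) : exists s,
  [/\ path wadj (word x) s, last (word x) s = word y & size s = gdist x y].
Proof.
have [s [xs <- <-]] := gdist_path x y; exists (map val s).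
by rewrite last_map size_map; split=> //; apply: val_path.
Qed.

Lemma diam_tiling n : diam (tiling_graph n) <= spread * L ^ n.
Proof.
apply: diam_le => x y; apply: gdist_near.
by have := @near_all (word x) (word y); rewrite !size_word; apply.
Qed.

Lemma gdist_block n j (x y : tiling_graph n) : j <= n ->
  take (n - j) (word x) = take (n - j) (word y) -> gdist x y <= spread * L ^ j.
Proof.
move=> jn xy; apply: gdist_near.
rewrite -(cat_take_drop (n - j) (word x)) -(cat_take_drop (n - j) (word y)) xy.
apply: near_cat; have := @near_all (drop (n - j) (word x)) (drop (n - j) (word y)).
by rewrite !size_drop !size_word subKn //; apply.
Qed.

(** * Volume growth of balls *)

Lemma path_cen w s t : path wadj w s ->
  wcen (last w s) t <= wcen w t + (b ^ size w * size s).*2 /\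
  wcen w t <= wcen (last w s) t + (b ^ size w * size s).*2.
Proof.
elim: s w => [|v s IH] w /=; first by rewrite muln0 !addn0.
case/andP=> wv /IH; rewrite -(wadj_size wv).
have := wadj_cen t wv; have := wadj_cen t (w := v) (w' := w); rewrite wadj_sym => /(_ wv).
have := wside_le v; have := wside_le w; rewrite -(wadj_size wv) mulnS.
by move: (b ^ _) (wcen (last v s) t) => B l; lia.
Qed.

Lemma gdist_cen n (x y : tiling_graph n) t (A := b ^ n * gdist x y) :
  wcen (word y) t <= wcen (word x) t + A.*2 /\
  wcen (word x) t <= wcen (word y) t + A.*2.
Proof.
rewrite /A; have [s [xs <- <-]] := gdist_words x y.
by have := path_cen t xs; rewrite size_word.
Qed.

Lemma wcen_take w m j t : size w = m + j ->
  (H ^ j * wpos (take m w) t).*2 <= wcen w t /\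
  wcen w t <= (H ^ j * (wpos (take m w) t + wside (take m w))).*2.
Proof.
move=> szw; rewrite -{2 3}(cat_take_drop m w) wcen_cat size_drop szw addKn.
split; first exact: leq_addr.
rewrite mulnDr doubleD leq_add2l [_ ^ _ * _]mulnC doubleMr leq_mul2l.
have := wpos_bound (drop m w) t; rewrite size_drop szw addKn /wcen.
by move=> ?; apply/orP; right; lia.
Qed.

Lemma wside_take w m j : size w = m + j -> wside w <= wside (take m w) * b ^ j.
Proof.
move=> szw; rewrite -{1}(cat_take_drop m w) wside_cat leq_mul2l.
by have := wside_le (drop m w); rewrite size_drop szw addKn => ->; rewrite orbT.
Qed.

(* Within [r] steps one cannot leave the neighbourhood of a cube of [j]-fold
   subdivision. *)
Definition slow r j := (r.*2 + b + 1) * b ^ 2 < (L ^ j).*2.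

(** Induction along the path: while its blocks have side comparable to that of [p], each step is
    short; a first block of incomparable side would lie beyond a gap that [slow] makes too wide to
    cross. *)
Lemma path_stay w m j s (p := take m w) (y := take m (last w s))
    (A := (size s * (b ^ j.+1 * wside p)).*2) :
  size w = m + j -> path wadj w s -> slow (size s) j ->
  [/\ wside p <= b * wside y, wside y <= b * wside p &
      forall t, wcen (last w s) t <= wcen w t + A /\
                wcen w t <= wcen (last w s) t + A].
Proof.
rewrite {}/A {}/y => szw; elim/last_ind: s => [|s z IH] /=.
  move=> _ _; rewrite mul0n; split=> [||t]; rewrite ?addn0 //; exact: leq_pmull.
rewrite rcons_path last_rcons size_rcons => /andP[ws lz] far.
have [|IH1 IH2 IH3] := IH ws.
  by apply: leq_ltn_trans far; rewrite leq_mul2r; apply/orP; right; lia.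
move: lz (last_cat) IH1 IH2 IH3; set v := last w s => vz _ IH1 IH2 IH3.
have szv : size v = m + j.
  rewrite -szw /v; elim: (s) (w) ws => //= u s1 IHs w1 /andP[/wadj_size-> /IHs->//].
have szz : size z = m + j by rewrite -(wadj_size vz).
set S := wside p in IH1 IH2 IH3 *; set B := b ^ j.+1 in IH3 *.
have vS : wside v <= B * S.
  apply: leq_trans (wside_take szv) _; rewrite /B expnS.
  by rewrite [_ * S]mulnAC leq_mul2r IH2 orbT.
have vz1 t := wadj_cen t vz.
have zv1 t : wcen z t <= wcen v t + wside z + wside v.
  by apply: wadj_cen; rewrite wadj_sym.
(* Comparability of the block of [z] is not yet known, so its side costs an extra factor [b]; this
   is the summand [b] in [slow]. *)
have zS : wside z <= b * (B * S).
  apply: (@leq_trans (b * wside v)); last by rewrite leq_mul2l vS orbT.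
  by apply: wadj_ratio; rewrite wadj_sym.
have szp : size p = size (take m z).
  by rewrite !size_take szw szz.
have [[pz zp]|[t [g [_ Sg gap]]]] := word_gap szp; last first.
  exfalso; have [x1 x2] := wcen_take t szw; have [z1 z2] := wcen_take t szz.
  have [v1 v2] := IH3 t; move: (vz1 t) (zv1 t) => {}vz1 {}zv1.
  have gapB : (H ^ j * g).*2 <= (size s * (B * S)).*2 + B * S + b * (B * S).
    rewrite -/p in x1 x2; have gap2 : H ^ j * (wpos p t + S) + H ^ j * g <=
        H ^ j * wpos (take m z) t \/
        H ^ j * (wpos (take m z) t + wside (take m z)) + H ^ j * g <=
        H ^ j * wpos p t.
      by case: gap => gap; [left|right]; rewrite -mulnDr leq_mul2l gap orbT.
    by move: (H ^ j * g) (H ^ j * _) (H ^ j * _) (H ^ j * _) (H ^ j * _) gap2 x1 x2 z1 z2; lia.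
  have : (b ^ j * L ^ j * S).*2 <= ((size s).*2 + b + 1) * b ^ 2 * (b ^ j * S).
    apply: (@leq_trans (b * (H ^ j * g).*2)).
      rewrite expnMn -doubleMr leq_double mulnCA leq_mul2l; apply/orP; right.
      exact: Sg.
    apply: leq_trans (leq_mul (leqnn b) gapB) _; rewrite /B expnS -!muln2; lia.
  rewrite leqNgt => /negP; apply; move: far; rewrite /slow => far.
  have bS : 0 < b ^ j * S by rewrite muln_gt0 expn_gt0 b_gt0 wside_gt0.
  apply: (@leq_trans ((L ^ j).*2 * (b ^ j * S))).
    rewrite ltn_pmul2r //; apply: leq_ltn_trans far.
    by rewrite leq_mul2r; apply/orP; right; lia.
  by rewrite -!muln2; lia.
split=> // t; have [v1 v2] := IH3 t; move: (vz1 t) (zv1 t).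
have {}zS : wside z <= B * S.
  apply: leq_trans (wside_take szz) _; rewrite /B expnS.
  by rewrite [_ * S]mulnAC leq_mul2r zp orbT.
by rewrite mulSn doubleD; lia.
Qed.

Definition nball n (x : tiling_graph n) k := [set y | gdist x y <= k].

Lemma nball_ge n j (x : tiling_graph n) k : j <= n -> spread * L ^ j <= k ->
  #|tile : predArgType| ^ j <= #|nball x k|.
Proof.
move=> jn jk; rewrite -card_tuple.
have /fin_all_exists[f fE] (u : j.-tuple tile) :
    exists y : tiling_graph n, word y = take (n - j) (word x) ++ u.
  apply: word_onto; rewrite size_cat size_takel ?size_word ?leq_subr //.
  by rewrite subnK.
have finj : injective f.
  by move=> u v /(congr1 (@word n)); rewrite !fE => /eqP; rewrite eqseq_cat // eqxx => /eqP/val_inj.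
apply: (@leq_trans #|codom f|); first by rewrite card_codom.
apply: subset_leq_card; apply/fintype.subsetP => _ /codomP[u ->].
rewrite inE; apply: leq_trans (gdist_block jn _) jk.
by rewrite fE take_size_cat // size_takel ?size_word ?leq_subr.
Qed.

(** In each coordinate the corners of the blocks met range over a window of length [(b + 3) * S],
    cut into steps [l] with [S <= b * l], where [S] is the side of the block of the centre. *)
Definition overlap := b * (b + 3) + 1.

(* The blocks met by the ball are disjoint cubes of comparable sides in a window,
   hence determined by their corners rounded down to multiples of [l]. *)
Lemma nball_le n j (x : tiling_graph n) k : slow k j ->
  #|nball x k| <= overlap ^ d * #|tile : predArgType| ^ j.
Proof.
have [jn|nj] := leqP j n; last first.
  move=> _; apply: leq_trans (max_card _) _; rewrite card_tuple.
  apply: (@leq_trans (#|tile : predArgType| ^ j)).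
    by rewrite leq_pexp2l ?(ltnW nj) //; apply/card_gt0P; exists hubt.
  by rewrite leq_pmull // expn_gt0 /overlap addn1.
move=> kj; pose m := n - j; have szn (y : tiling_graph n) : size (word y) = m + j.
  by rewrite size_word subnK.
pose p := take m (word x); pose S := wside p.
have S0 : 0 < S by exact: wside_gt0.
have stay (y : tiling_graph n) : y \in nball x k ->
    [/\ S <= b * wside (take m (word y)), wside (take m (word y)) <= b * S &
     forall t, wpos p t <= wpos (take m (word y)) t + (b + 1) * S /\
               wpos (take m (word y)) t <= wpos p t + 2 * S].
  rewrite inE => yk; have [s [xs ls sk]] := gdist_words x y.
  have kj' : slow (size s) j.
    apply: leq_ltn_trans kj; rewrite leq_mul2r sk !leq_add2r leq_double yk orbT //.
  have [] := path_stay (szn x) xs kj'; rewrite ls -/p -/S => pS yS near.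
  split=> // t; have [n1 n2] := near t.
  have [x1 x2] := wcen_take t (szn x); have [y1 y2] := wcen_take t (szn y).
  have HS : (size s * (b ^ j.+1 * S)).*2 <= (H ^ j * S).*2.
    have sL : size s * b <= L ^ j.
      rewrite -leq_double; apply: leq_trans (ltnW kj').
      by rewrite expnS expn1 -!muln2; have := b_gt0; nia.
    rewrite leq_double expnS expnMn [b ^ j * _]mulnC -!mulnA [leqLHS]mulnA.
    by rewrite leq_mul2r sL orbT.
  have A0 : 0 < H ^ j by rewrite expn_gt0 H_gt0.
  rewrite -/p -/S in x1 x2; split; rewrite -(leq_pmul2l A0) -leq_double.
    have := leq_mul (leqnn (H ^ j)) yS; rewrite mulnDr in y2.
    rewrite mulnDr mulnDl mul1n (mulnDr _ (b * S)).
    by move: x1 y2 HS n2; lia.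
  rewrite mulnDr mulnCA; move: x2; rewrite mulnDr.
  by move: (H ^ j * _) (H ^ j * _) (H ^ j * _) y1 HS n1; lia.
(* [l] is [S / b] rounded up: it is at most the side of every block met, so disjoint blocks get
   different rounded corners. *)
pose l := S.-1 %/ b + 1.
have l0 : 0 < l by rewrite /l addn1.
have lS y : S <= b * y -> l <= y.
  move=> Sy; rewrite /l addn1 ltn_divLR ?b_gt0 // mulnC; lia.
have Sl : S <= b * l.
  by have := divn_eq S.-1 b; have := ltn_pmod S.-1 b_gt0; rewrite /l; nia.
pose q (w : seq tile) t := (wpos w t - (wpos p t - (b + 1) * S)) %/ l.
pose f (y : tiling_graph n) : {ffun 'I_d -> 'I_(overlap.-1.+1)} * j.-tuple tile :=
  ([ffun t => inord (q (take m (word y)) t)], insubd (nseq_tuple j hubt) (drop m (word y))).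
have -> : overlap ^ d * #|tile : predArgType| ^ j =
   #|{: {ffun 'I_d -> 'I_(overlap.-1.+1)} * j.-tuple tile}|.
  by rewrite card_prod card_ffun card_tuple !card_ord prednK // /overlap addn1.
have finj : {in nball x k &, injective f}.
  move=> y z yb zb [/ffunP E1 /(congr1 val)]; rewrite !val_insubd !size_drop !szn.
  rewrite addKn eqxx => E2; apply: word_inj.
  rewrite -(cat_take_drop m (word y)) -(cat_take_drop m (word z)) E2; congr cat.
  have [y1 _ y3] := stay y yb; have [z1 _ z3] := stay z zb.
  have qE w t : S <= b * wside w -> wpos w t <= wpos p t + 2 * S -> q w t <= overlap.-1.
    move=> _ wt; rewrite /overlap addn1 /= /q.
    apply: (@leq_trans ((b + 3) * S %/ l)).
      apply: leq_div2r; rewrite leq_subLR !mulnDl; lia.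
    rewrite -ltnS ltn_divLR // mulSn.
    by have := leq_mul (leqnn (b + 3)) Sl; rewrite mulnA [(b + 3) * b]mulnC; lia.
  apply/eqP/negPn/negP => /(word_sep _)[|t sep].
    by rewrite !size_take !szn.
  have /(congr1 val) := E1 t; rewrite !ffunE /= !inordK ?ltnS;
    [|exact: qE (z3 t).2|exact: qE (y3 t).2].
  have sepq w w' : l <= wside w -> wpos w t + wside w <= wpos w' t ->
      wpos p t <= wpos w t + (b + 1) * S -> q w t < q w' t.
    move=> lw ww' pw; rewrite /q; set A := _ - _; set A' := wpos w' t - _.
    have -> : (A %/ l).+1 = (A + l) %/ l by rewrite divnDr // divnn l0 addn1.
    by apply: leq_div2r; rewrite /A /A'; lia.
  by case: sep => [/(sepq _ _ (lS _ y1))/(_ (y3 t).1)|/(sepq _ _ (lS _ z1))/(_ (z3 t).1)];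
    rewrite ltn_neqAle => /andP[/eqP] ? _ E; [|symmetry in E].
by rewrite -(card_in_imset finj) max_card.
Qed.

(** * Vertical columns *)

(** [fine] ignores the vertical coordinate, and a coarse tile only needs the divisibility. *)
Lemma mkt_upd0 x i : i < H -> tside x %| i ->
  (forall t, tpos (mkt (upd (tpos x) ord0 i)) t = upd (tpos x) ord0 i t) /\
  fine (val (mkt (upd (tpos x) ord0 i))) = fine (val x).
Proof.
move=> iH si.
have xH t : tpos x t < H by have := tpos_bound x t; have := tside_gt0 x; lia.
have uH t : upd (tpos x) ord0 i t < H by rewrite /upd; case: ifP.
have [xf|xf] := boolP (fine (val x)).
  have [//|t t0|fE fF] := @mkt_fine (upd (tpos x) ord0 i); last by rewrite fF.
  rewrite /upd (negbTE t0); have /implyP/(_ t0)/andP[] := forallP xf t.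
  by rewrite ltn_subRL addnC.
case: (tileP x) si => [fx _|_ bx _ [t t0 xt]] si.
  by case/negP: xf; apply/forallP=> t; apply/implyP=> /fx[]; rewrite ltn_subRL addnC => -> ->.
have [//|t'|//||fE /negbTE fF] := @mkt_coarse (upd (tpos x) ord0 i) t; last by rewrite fF.
- by rewrite /upd; case: ifP.
- by rewrite /upd (negbTE t0).
Qed.

Definition bot x := mkt (upd (tpos x) ord0 0).

Lemma botE x :
  (forall t, tpos (bot x) t = upd (tpos x) ord0 0 t) /\ tside (bot x) = tside x.
Proof. by have [fE fF] := mkt_upd0 (H_gt0) (dvdn0 (tside x)); rewrite /tside fF. Qed.

Lemma bot_upd x i : i < H -> tside x %| i ->
  bot (mkt (upd (tpos x) ord0 i)) = bot x.
Proof.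
move=> iH si; have [fE _] := mkt_upd0 iH si; apply: eq_mkt => t.
by rewrite /upd; case: eqP => // /eqP/negbTE t0; rewrite fE /upd t0.
Qed.

(* [map bot w] is the lowest cube of the vertical column through [w]. *)
Lemma column_wside w w' : map bot w = map bot w' -> wside w = wside w'.
Proof.
suff botS v : wside (map bot v) = wside v by move=> ww'; rewrite -botS ww' botS.
by elim: v => //= x v ->; rewrite (botE x).2.
Qed.

Lemma bot_wpos w t : wpos (map bot w) t = if t == ord0 then 0 else wpos w t.
Proof.
elim: w => [|x w IH] /=; first by case: ifP.
rewrite size_map (botE x).1 (botE x).2 IH /upd.
by case: ifP; rewrite ?muln0.
Qed.

Lemma column_wpos w w' t : map bot w = map bot w' -> t != ord0 -> wpos w t = wpos w' t.
Proof. by move=> ww' /negbTE t0; have := bot_wpos w t; rewrite ww' bot_wpos t0. Qed.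

Lemma column_adj w w' : map bot w = map bot w' ->
  wpos w ord0 + wside w = wpos w' ord0 -> wadj w w'.
Proof.
move=> ww' step; apply: wadj_contact step _; first by rewrite -(size_map bot) ww' size_map.
by move=> t t0; rewrite /wcen (column_wpos ww' t0) (column_wside ww').
Qed.

Lemma dvd_tpos x : tside x %| tpos x ord0.
Proof. by case: tileP => [_ _|_ dx _ _] //; rewrite dvd1n. Qed.

(** Addition with carry: raise the tail if it is not at the top of its tile; otherwise reset the
    tail to the bottom and raise the first letter by its own side. *)
Lemma above w : wpos w ord0 + wside w < H ^ size w ->
  exists2 w', map bot w = map bot w' & wpos w ord0 + wside w = wpos w' ord0.
Proof.
elim: w => [|x u IH] //=; rewrite -addnA -mulnDr.
have [ltu _|geu] := ltnP (wpos u ord0 + wside u) (H ^ size u).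
  have [u' uu' E] := IH ltu; exists (x :: u'); first by rewrite /= uu'.
  by rewrite /= E -(size_map bot u) uu' size_map.
have uE : wpos u ord0 + wside u = H ^ size u.
  by apply/eqP; rewrite eqn_leq geu wpos_bound.
rewrite uE [tside x * _]mulnC -mulnDr expnS [H * _]mulnC ltn_pmul2l ?expn_gt0 ?H_gt0 // => ltH.
have dvd0 : tside x %| tpos x ord0 + tside x by rewrite dvdn_addl ?dvd_tpos.
have [fE fF] := mkt_upd0 ltH dvd0.
exists (mkt (upd (tpos x) ord0 (tpos x ord0 + tside x)) :: map bot u) => /=.
  rewrite bot_upd // -map_comp; congr cons; apply: eq_map => y /=.
  by rewrite /bot; apply/esym; apply: bot_upd; rewrite ?H_gt0.
by rewrite fE bot_wpos eqxx muln0 addn0 size_map.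
Qed.

Definition top x := mkt (upd (tpos x) ord0 (H - tside x)).

Lemma topE x : [/\ tpos (top x) ord0 = H - tside x, tside (top x) = tside x &
  bot (top x) = bot x].
Proof.
have ltH : H - tside x < H by rewrite ltn_subrL tside_gt0 H_gt0.
have dvdH : tside x %| H - tside x.
  by rewrite dvdn_sub //; case: tileP => [_ _|_ _ _ _] //; rewrite ?dvd1n ?dvdn_mulr.
have [fE fF] := mkt_upd0 ltH dvdH.
by split; [rewrite fE /upd eqxx|rewrite /tside fF|rewrite bot_upd].
Qed.

Lemma top_column u : map bot (map top u) = map bot u.
Proof. by rewrite -map_comp; apply: eq_map => x /=; have [] := topE x. Qed.

Lemma top_wpos u : wpos (map top u) ord0 + wside u = H ^ size u.
Proof.
elim: u => //= x u IH; have [-> -> _] := topE x; rewrite -addnA -mulnDr IH size_map.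
rewrite [tside x * _]mulnC -mulnDr subnK ?expnSr //.
by have := tpos_bound x ord0; lia.
Qed.

(** Subtraction with borrow, the mirror image of [above]: [map top] resets a tail that is already at
    the bottom. *)
Lemma below w : 0 < wpos w ord0 ->
  exists2 w', map bot w = map bot w' & wpos w' ord0 + wside w' = wpos w ord0.
Proof.
suff: 0 < wpos w ord0 -> exists2 w', map bot w = map bot w' &
    wpos w' ord0 + wside w = wpos w ord0.
  by move=> bw /bw[w' ww' E]; exists w'; rewrite // -(column_wside ww').
elim: w => [|x u IH] //=; have [u0|/IH[u' uu' E] _] := posnP (wpos u ord0).
  rewrite u0 muln0 addn0 muln_gt0 expn_gt0 H_gt0 /= => x0.
  have lex : tside x <= tpos x ord0 by rewrite dvdn_leq ?dvd_tpos.
  have ltH : tpos x ord0 - tside x < H.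
    by have := tpos_bound x ord0; have := tside_gt0 x; lia.
  have [fE fF] := mkt_upd0 ltH (dvdn_sub (dvd_tpos x) (dvdnn _)).
  exists (mkt (upd (tpos x) ord0 (tpos x ord0 - tside x)) :: map top u) => /=.
    by rewrite bot_upd ?dvdn_sub ?dvd_tpos // top_column.
  rewrite fE /upd eqxx size_map -addnA.
  have -> : tside (mkt (upd (tpos x) ord0 (tpos x ord0 - tside x))) = tside x.
    by rewrite /tside fF.
  by rewrite -mulnDr top_wpos [tside x * _]mulnC -mulnDr subnK.
exists (x :: u'); first by rewrite /= uu'.
by rewrite /= -addnA -mulnDr E -(size_map bot u) uu' size_map.
Qed.

Lemma chain (T : eqType) (r : rel T) (f : T -> nat) (stop : pred T) :
  (forall x, ~~ stop x -> exists2 y, r x y & f y < f x) ->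
  forall x, exists s, [/\ path r x s, uniq (x :: s) & stop (last x s)].
Proof.
move=> next x; suff [s xs stops] : exists2 s,
    path (fun x y => r x y && (f y < f x)) x s & stop (last x s).
  exists s; split=> //; first by apply: sub_path xs => y z /andP[].
  apply: (@sorted_uniq _ (fun y z => f z < f y)) => [y1 y2 y3||].
  - by move=> y12 y23; apply: ltn_trans y23 y12.
  - by move=> y; rewrite ltnn.
  - by apply: sub_path xs => y z /andP[].
have [n] := ubnP (f x); elim: n x => // n IH x xn.
have [sx|/next[y xy yx]] := boolP (stop x); first by exists [::].
have [|s ys ss] := IH y; first exact: leq_trans yx _.
by exists (y :: s) => //=; rewrite xy yx.
Qed.

Definition column_step n (x y : tiling_graph n) :=
  adj x y && (map bot (word x) == map bot (word y)).

(** Follow the column away from [x]: up if [x] lies in the lower half, down otherwise. At the end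
    the doubled height differs by at least [H ^ n - b ^ n], and one step changes it by at most
    [2 * b ^ n]. *)
Lemma column_path n (x y : tiling_graph n) : exists s : seq (tiling_graph n),
  [/\ path (@column_step n) y s, uniq (y :: s) &
      (L ^ n).-1 <= (gdist x (last y s)).*2].
Proof.
have HE : H ^ n = b ^ n * L ^ n by rewrite expnMn.
have far (z : tiling_graph n) :
    wcen (word x) ord0 + H ^ n <= wcen (word z) ord0 + b ^ n \/
    wcen (word z) ord0 + H ^ n <= wcen (word x) ord0 + b ^ n ->
    (L ^ n).-1 <= (gdist x z).*2.
  have [xz zx] := gdist_cen x z ord0; rewrite HE => le.
  have : b ^ n * L ^ n <= b ^ n * ((gdist x z).*2 + 1).
    rewrite mulnDr muln1 -doubleMr; lia.
  by rewrite leq_pmul2l ?expn_gt0 ?b_gt0 //; lia.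
have szw (z : tiling_graph n) := size_word z.
have [xlow|xhigh] := leqP (wcen (word x) ord0) (H ^ n).
  have [z|s [ys us /eqP stop]] := @chain _ (@column_step n)
      (fun z => H ^ n - wpos (word z) ord0)
      (fun z => wpos (word z) ord0 + wside (word z) == H ^ n) _ y.
    move=> zH; have zb := wpos_bound (word z) ord0; rewrite szw in zb.
    have [|w' zw' E] := @above (word z); first by rewrite szw ltn_neqAle zH.
    have [|z' z'E] := @word_onto n w'; first by rewrite -(size_map bot) -zw' size_map szw.
    exists z'; first by rewrite /column_step z'E zw' eqxx andbT; apply: (@column_adj (word z) (word z')); rewrite z'E.
    rewrite z'E -E; have := wside_gt0 (word z); move: zH; lia.
  exists s; split=> //; apply: far; left; set z := last y s.
  have {}stop : wpos (word z) ord0 + wside (word z) = H ^ n := stop.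
  by have := wside_le (word z); rewrite szw; move: stop xlow; rewrite /wcen; lia.
have [z|s [ys us /eqP stop]] := @chain _ (@column_step n)
    (fun z => wpos (word z) ord0) (fun z => wpos (word z) ord0 == 0) _ y.
  rewrite -lt0n => z0; have [w' zw' E] := below z0.
  have [|z' z'E] := @word_onto n w'; first by rewrite -(size_map bot) -zw' size_map szw.
  exists z'; last by rewrite z'E -E; have := wside_gt0 w'; lia.
  rewrite /column_step z'E zw' eqxx andbT /= /tadj wadj_sym.
  by apply: (@column_adj (word z') (word z)); rewrite z'E.
exists s; split=> //; apply: far; right; set z := last y s.
have {}stop : wpos (word z) ord0 = 0 := stop.
by have := wside_le (word z); rewrite szw; move: stop xhigh; rewrite /wcen; lia.
Qed.

Lemma diam_large n : (L ^ n).-1 <= (diam (tiling_graph n)).*2.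
Proof.
have [x _] : exists x : tiling_graph n, true.
  by have /card_gt0P[x _] := vert_gt0 (tiling_graph n); exists x.
have [s [_ _ h]] := column_path x x; apply: leq_trans h _.
by rewrite leq_double leq_diam.
Qed.

(** The representative, at height [0], of a column of unit tiles in one substitution step; [e.+2] is
    [d - 1]. *)
Definition shaft (g : {ffun 'I_(e.+2) -> 'I_(b * (L - 2))}) :=
  mkt (fun t => if unlift ord0 t is Some i then b + g i else 0).

Lemma shaftE g t : tpos (shaft g) t = if unlift ord0 t is Some i then b + g i else 0.
Proof.
have gH i : b + g i + b <  H.
  have := ltn_ord (g i); have -> : H = b * (L - 2) + b * 2 by rewrite -mulnDr subnK // ltnW.
  lia.
have b0 := b_gt0; rewrite /shaft; set f := fun t => _.
have [i|i i0|-> //] := @mkt_fine f; rewrite /f.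
  by case: unliftP => [j|] _; [have := gH j|]; lia.
by move: i0; case: unliftP => [j _ _|->]; [have := gH j; lia|rewrite eqxx].
Qed.

Lemma bot_shaft g : bot (shaft g) = shaft g.
Proof.
apply: tpos_inj => t; rewrite (botE _).1 /upd.
by case: eqP => [->|//]; rewrite shaftE unlift_none.
Qed.

Lemma shaft_inj : injective shaft.
Proof.
move=> g g' gg'; apply/ffunP => i; apply/val_inj.
have := shaftE g (lift ord0 i); rewrite gg' shaftE liftK => /eqP.
by rewrite eqn_add2l => /eqP.
Qed.

(** Start a column at each word of [j] shafts inside the block of [x]. It begins within distance [k]
    of [x] and ends beyond [k'], so it crosses both spheres, and [map bot] tells the columns
    apart. *)
Lemma disjoint_columns n j (x : tiling_graph n) k k' : j <= n ->
  (j = 0 \/ spread * L ^ j <= k) -> k <= k' -> k'.*2 < L ^ n ->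
  exists ps : seq (seq (tiling_graph n)),
    vertex_disjoint_paths (gsphere x k) (gsphere x k') ps /\
    size ps = ((b * (L - 2)) ^ e.+2) ^ j.
Proof.
move=> jn jk kk' k'n; pose m := n - j; pose I := {ffun 'I_(e.+2) -> 'I_(b * (L - 2))}.
have szx : size (take m (word x)) = m by rewrite size_takel // size_word leq_subr.
have one (u : j.-tuple I) : exists p : seq (tiling_graph n),
    path_between (gsphere x k) (gsphere x k') p /\
    {in p, forall z, map bot (word z) = map bot (take m (word x)) ++ map shaft u}.
  have [|y yE] := @word_onto n (take m (word x) ++ map shaft u).
    by rewrite size_cat szx size_map size_tuple subnK.
  have [s [ys us far]] := column_path x y.
  have yk : gdist x y <= k.
    (* For [j = 0] the single column is started at [x] itself. *)
    case: jk => [j0|]; last first.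
      by apply: leq_trans; apply: gdist_block; rewrite // yE take_size_cat.
    suff -> : y = x by rewrite gdistxx.
    apply: word_inj; rewrite yE; case: (tval u) (size_tuple u) => [_|i t /=].
      by rewrite cats0 /m j0 subn0 take_oversize // size_word.
    by rewrite j0.
  have [||p pb sub] := @crossing_path _ x y s k k' _ us kk' yk.
  - by apply: sub_path ys => z z' /andP[].
  - lia.
  exists p; split=> // z /sub; rewrite -[RHS]cats0.
  have -> : map bot (take m (word x)) ++ map shaft u = map bot (word y).
    by rewrite yE map_cat -map_comp; congr (_ ++ _); apply: eq_map => g /=; rewrite bot_shaft.
  rewrite cats0 => {us far pb sub yE yk}.
  elim: s y ys => [|y' s IH] y /=; first by move=> _; rewrite inE => /eqP->.
  move=> /andP[/andP[_ /eqP yy'] ys]; rewrite in_cons => /orP[/eqP->//|].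
  by rewrite yy'; exact: IH.
have [f fP] := fin_all_exists one.
exists (map f (enum {: j.-tuple I})); split; last first.
  by rewrite size_map -cardE card_tuple card_ffun !card_ord.
apply/andP; split; first by apply/allP => _ /mapP[u _ ->]; have [] := fP u.
rewrite pairwise_map; have := enum_uniq {: j.-tuple I}; rewrite uniq_pairwise.
apply: sub_pairwise => u v uv /=; apply/pred0P => z /=; apply/negP => /andP[zu zv].
have [_ /(_ z zu) Eu] := fP u; have [_ /(_ z zv) Ev] := fP v.
case/eqP: uv; apply/val_inj; move: Ev; rewrite Eu => /eqP.
by rewrite eqseq_cat // eqxx => /eqP/(inj_map shaft_inj).
Qed.

(** * Growth and path exponents *)

Section Reals.
Variable R : realType.
Local Open Scope ring_scope.

Definition center n (x : tiling_graph n) : 'rV[R]_d :=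
  \row_t (wcen (word x) t)%:R.

Definition radius n (x : tiling_graph n) : R := (wside (word x))%:R.

Lemma center_sep n (x y : tiling_graph n) : x != y ->
  exists t, radius x + radius y <= `|center x 0 t - center y 0 t|.
Proof.
move=> xy; have szxy : size (word x) = size (word y) by rewrite !size_word.
have [|t sep] := word_sep szxy; first by apply: contra xy => /eqP/word_inj->.
exists t; rewrite !mxE /radius -natrD; case: sep => sep; last first.
  apply: le_trans (ler_norm _).
  by rewrite lerBrDr -natrD ler_nat /wcen; lia.
rewrite distrC; apply: le_trans (ler_norm _).
by rewrite lerBrDr -natrD ler_nat /wcen; lia.
Qed.

Lemma adj_centers n (x y : tiling_graph n) : x != y ->
  adj x y <-> \sum_t (center x 0 t - center y 0 t) ^+ 2 = (radius x + radius y) ^+ 2.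
Proof.
move=> xy; have -> : \sum_t (center x 0 t - center y 0 t) ^+ 2 =
    (\sum_t ((wcen (word x) t)%:Z - (wcen (word y) t)%:Z) ^+ 2)%:~R.
  rewrite rmorph_sum; apply: eq_bigr => t _.
  by rewrite !mxE rmorphXn rmorphB /= !pmulrn.
have -> : (radius x + radius y) ^+ 2 = (((wside (word x) + wside (word y))%:Z) ^+ 2)%:~R.
  by rewrite rmorphXn /= -natrD pmulrn.
split=> [/and3P[_ _ /eqP->]//|/intr_inj E]; apply/and3P; split.
- by rewrite !size_tuple.
- by apply: contra xy => /eqP/word_inj->.
- by apply/eqP.
Qed.

Lemma tiling_packed n (M : R) : b%:R <= M -> sphere_packed d M (tiling_graph n).
Proof.
move=> bM; exists (@center n), (@radius n).
have r0 (x : tiling_graph n) : 0 < radius x by rewrite ltr0n wside_gt0.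
have tan (x y : tiling_graph n) : x != y -> adj x y <-> tangent (center x) (radius x) (center y) (radius y).
  move=> xy; have [t sep] := center_sep xy.
  have T := tangentP (r0 x) (r0 y) sep; have A := adj_centers xy.
  by split=> [/A/T|/T/A].
split=> // [x y xy|x y xy /(tan x y xy) xy1].
  by have [t sep] := center_sep xy; exact: balls_disjoint sep.
have yx1 : adj y x by rewrite adj_sym.
have M0 : 0 < M by apply: lt_le_trans bM; rewrite ltr0n b_gt0.
have half (u v : tiling_graph n) : adj u v -> radius u <= M * radius v.
  move=> uv; apply: (@le_trans _ _ (b%:R * radius v)).
    by rewrite -natrM ler_nat; exact: (wadj_ratio uv).
  by rewrite ler_wpM2r // ltW.
by rewrite ler_pdivlMr // ler_pdivrMr // half // mulrC ler_pdivrMr // mulrC half.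
Qed.

Definition growth : R := ln (#|tile : predArgType|%:R) / ln L%:R.

Lemma L_gt1 : 1 < L%:R :> R. Proof. by rewrite ltr1n ltnW. Qed.

Lemma tile_gt0 : (0 < #|tile : predArgType|)%N.
Proof. by apply/card_gt0P; exists hubt. Qed.

Lemma growthE : L%:R `^ growth = #|tile : predArgType|%:R.
Proof.
have lnL : 0 < ln L%:R :> R by rewrite ln_gt0 // L_gt1.
apply: ln_inj; rewrite ?posrE ?powR_gt0 ?ltr0n ?tile_gt0 //; first by lia.
by rewrite ln_powR divfK // gt_eqF.
Qed.

Lemma growth_ge0 : 0 <= growth.
Proof. by rewrite divr_ge0 // ln_ge0 // ler1n ?tile_gt0 //; lia. Qed.

Lemma powR_expL (s : R) j : (L ^ j)%:R `^ s = (L%:R `^ s) ^+ j.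
Proof.
by rewrite natrX -powR_mulrn // -powRrM mulrC powRrM powR_mulrn // powR_ge0.
Qed.

Lemma nat_powR_le (s : R) m m' : 0 <= s -> (m <= m')%N -> m%:R `^ s <= m'%:R `^ s.
Proof. by move=> s0 mm; rewrite ge0_ler_powR // ?nnegrE // ler_nat. Qed.

Lemma spread_gt0 : (0 < spread)%N.
Proof. by rewrite /spread /reach; lia. Qed.

(** [j] is the least index satisfying the upper bound; minimality gives the lower one, except at
    [j = 0], which also covers radii below [spread]. *)
Lemma scale_below n k : (0 < k)%N -> (k <= spread * L ^ n)%N ->
  exists j, [/\ (j <= n)%N, j = 0%N \/ (spread * L ^ j <= k)%N &
                (k <= spread * L * L ^ j)%N].
Proof.
move=> k0 kn; have : exists j, (k <= spread * L ^ j.+1)%N.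
  by exists n; apply: leq_trans kn _; rewrite leq_mul2l leq_exp2l ?leqnSn ?orbT // ltnW.
case/ex_minnP=> j kj jmin; exists j; split; last by rewrite -mulnA -expnS.
- by apply: jmin; apply: leq_trans kn _; rewrite leq_mul2l leq_exp2l ?leqnSn ?orbT // ltnW.
- case: j {kj} jmin => [|j] jmin; [by left|right].
  by rewrite leqNgt; apply/negP => /ltnW/jmin; rewrite ltnn.
Qed.

Lemma scale_above k : (0 < k)%N ->
  exists j, slow k j /\ (L ^ j <= L * (b + 3) * b ^ 2 * k)%N.
Proof.
move=> k0; have b0 := b_gt0.
have : exists j, slow k j.
  exists ((k.*2 + b + 1) * b ^ 2)%N; rewrite /slow.
  by apply: leq_trans (ltn_expl _ (ltnW L_gt2)) _; rewrite -[leqRHS]addnn leq_addr.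
case/ex_minnP=> [[|j]] jk jmin; [exists 0%N|exists j.+1]; split=> //.
  by rewrite expn0 !muln_gt0 addn_gt0 b0 k0 (ltnW (ltnW L_gt2)).
have jk' : ((L ^ j).*2 <= (k.*2 + b + 1) * b ^ 2)%N.
  by rewrite leqNgt; apply/negP => /jmin; rewrite ltnn.
rewrite expnS -!(mulnA L) leq_mul2l; apply/orP; right.
rewrite -leq_double; apply: leq_trans jk' _.
have : (k.*2 + b + 1 <= ((b + 3) * k).*2)%N by rewrite -!muln2; nia.
by move=> h; apply: leq_trans (leq_mul h (leqnn _)) _; rewrite -!muln2; lia.
Qed.

Lemma gball_nball n (x : tiling_graph n) (r : R) : 0 <= r ->
  gball x r = nball x (Num.truncn r).
Proof. by move=> r0; apply/setP => y; rewrite !inE truncn_ge_nat. Qed.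

Lemma tile_card : (#|tile : predArgType| <= (b * L).+1 ^ d)%N.
Proof.
have <- : #|{: {ffun 'I_d -> 'I_(b * L).+1}}| = ((b * L).+1 ^ d)%N.
  by rewrite card_ffun !card_ord.
exact: (leq_card _ (@val_inj _ _ tile)).
Qed.

Lemma growth_le (s : R) : ((b * L).+1 ^ d)%:R <= L%:R `^ s -> growth <= s.
Proof.
have lnL : 0 < ln L%:R :> R by rewrite ln_gt0 // L_gt1.
have L0 : 0 < L%:R :> R by rewrite ltr0n; lia.
move=> le; rewrite /growth ler_pdivrMr // -ln_powR ler_ln ?posrE ?powR_gt0 ?ltr0n ?tile_gt0 //.
  by apply: le_trans le; rewrite ler_nat tile_card.
lia.
Qed.

Lemma growth_lower n (x : tiling_graph n) (r : R) :
  1 <= r -> r <= (diam (tiling_graph n))%:R ->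
  r `^ growth <= (2 * (spread * L))%:R `^ growth * #|gball x r|%:R.
Proof.
move=> r1 rd; have r0 : 0 <= r by apply: le_trans r1.
have /andP[kr rk] := truncn_itv r0; rewrite gball_nball //.
set k := Num.truncn r in kr rk *; have k0 : (0 < k)%N by rewrite truncn_gt0.
have kd : (k <= spread * L ^ n)%N.
  by apply: leq_trans (diam_tiling n); rewrite -(ler_nat R); apply: le_trans rd.
have [j [jn jk kj]] := scale_below k0 kd.
apply: (@le_trans _ _ ((2 * (spread * L) * L ^ j)%:R `^ growth)).
  rewrite ge0_ler_powR ?growth_ge0 ?nnegrE //; apply: le_trans (ltW rk) _.
  by rewrite ler_nat; lia.
rewrite natrM powRM // powR_expL growthE -natrX ler_wpM2l ?powR_ge0 // ler_nat.
case: jk => [->|jk]; last exact: nball_ge.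
by rewrite expn0; apply/card_gt0P; exists x; rewrite inE gdistxx.
Qed.

Lemma growth_upper n (x : tiling_graph n) (r : R) : 1 <= r ->
  #|gball x r|%:R <=
  (overlap ^ d)%:R * (L * (b + 3) * b ^ 2)%:R `^ growth * r `^ growth.
Proof.
move=> r1; have r0 : 0 <= r by apply: le_trans r1.
have /andP[kr _] := truncn_itv r0; rewrite gball_nball //.
set k := Num.truncn r in kr *; have k0 : (0 < k)%N by rewrite truncn_gt0.
have [j [kj jk]] := scale_above k0.
apply: (@le_trans _ _ (overlap ^ d * #|tile : predArgType| ^ j)%:R).
  by rewrite ler_nat nball_le.
rewrite natrM -mulrA ler_wpM2l // natrX -growthE -powR_expL -powRM //.
rewrite ge0_ler_powR ?growth_ge0 ?nnegrE ?mulr_ge0 //.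
apply: (@le_trans _ _ (L * (b + 3) * b ^ 2 * k)%:R); first by rewrite ler_nat.
by rewrite natrM ler_wpM2l.
Qed.

(** In [c], the summand [4 * spread] forces [4 * k' <= L ^ n], so the columns reach beyond [k']; the
    other one absorbs the rounding of [k] to a scale [L ^ j]. Its exponent [K] makes [c] independent
    of [s]. *)
Lemma many_paths n (x : tiling_graph n) (K s c : R) k k' :
  c = ((spread * L)%:R `^ K + (4 * spread)%:R)^-1 ->
  0 <= s -> s <= K -> L%:R `^ s <= ((b * (L - 2)) ^ e.+2)%:R ->
  (1 <= k)%N -> (k < k')%N -> k'%:R <= c * (diam (tiling_graph n))%:R ->
  exists ps : seq (seq (tiling_graph n)),
    vertex_disjoint_paths (gsphere x k) (gsphere x k') ps /\
    c * k%:R `^ s <= (size ps)%:R.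
Proof.
move=> cE s0 sK sP k0 kk' k'd.
have T0 : 0 < spread%:R :> R by rewrite ltr0n spread_gt0.
have TL1 : 1 <= (spread * L)%:R :> R by rewrite ler1n muln_gt0 spread_gt0; lia.
have P0 : 0 < (spread * L)%:R `^ K :> R by rewrite powR_gt0 // (lt_le_trans ltr01).
have c0 : 0 < c by rewrite cE invr_gt0 addr_gt0 // ltr0n muln_gt0 spread_gt0.
have k'L : (4 * k' <= L ^ n)%N.
  have : k'%:R <= c * (spread%:R * (L ^ n)%:R).
    apply: le_trans k'd _; rewrite ler_wpM2l ?(ltW c0) // -natrM ler_nat.
    exact: diam_tiling.
  rewrite cE mulrC ler_pdivlMr; last by rewrite addr_gt0 // ltr0n muln_gt0 spread_gt0.
  move=> h; rewrite -(ler_nat R) natrM -(ler_pM2l T0); apply: le_trans h.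
  by rewrite [leLHS]mulrA [leLHS]mulrC [spread%:R * _]mulrC -natrM ler_wpM2l // lerDr ltW.
have kT : (k <= spread * L ^ n)%N.
  apply: (@leq_trans (L ^ n)); first by lia.
  by rewrite leq_pmull // spread_gt0.
have [j [jn jk kj]] := scale_below k0 kT.
have [|ps [psd pss]] := @disjoint_columns n j x k k' jn jk (ltnW kk') _; first by lia.
exists ps; split=> //; rewrite pss.
apply: (@le_trans _ _ (c * ((spread * L)%:R `^ K * (L%:R `^ s) ^+ j))).
  rewrite ler_wpM2l ?(ltW c0) //; apply: le_trans (nat_powR_le s0 kj) _.
  rewrite natrM powRM // powR_expL ler_wpM2r ?exprn_ge0 ?powR_ge0 //.
  exact: ler_powR.
rewrite mulrA; apply: (@le_trans _ _ (1 * (L%:R `^ s) ^+ j)).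
  rewrite ler_wpM2r ?exprn_ge0 ?powR_ge0 // cE mulrC ler_pdivrMr; last first.
    by rewrite addr_gt0 // ltr0n muln_gt0 spread_gt0.
  by rewrite mul1r lerDl.
by rewrite mul1r natrX lerXn2r ?nnegrE ?powR_ge0.
Qed.

(** Every larger constant [C'] is allowed, so that finitely many values of [b] can share one. *)
Lemma tiling_bounds (K : R) : exists C : R, 0 < C /\ forall C' : R, C <= C' ->
  [/\ forall n (x : tiling_graph n) (r : R), 1 <= r ->
        r <= (diam (tiling_graph n))%:R -> asymp C' #|gball x r|%:R (r `^ growth),
      forall n, exists m, (n <= diam (tiling_graph m))%N,
      exists M : R, M <= C' /\ forall n, sphere_packed d M (tiling_graph n) &
      exists c : R, C'^-1 <= c /\ forall s, 0 <= s -> s <= K ->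
        L%:R `^ s <= ((b * (L - 2)) ^ e.+2)%:R ->
        forall n (x : tiling_graph n) k k', (1 <= k)%N -> (k < k')%N ->
        k'%:R <= c * (diam (tiling_graph n))%:R ->
        exists ps : seq (seq (tiling_graph n)),
        vertex_disjoint_paths (gsphere x k) (gsphere x k') ps /\
        c * k%:R `^ s <= (size ps)%:R].
Proof.
pose C1 : R := (2 * (spread * L))%:R `^ growth.
pose C2 : R := (overlap ^ d)%:R * (L * (b + 3) * b ^ 2)%:R `^ growth.
pose Q : R := (spread * L)%:R `^ K + (4 * spread)%:R.
have C1_ge0 : 0 <= C1 by exact: powR_ge0.
have C2_ge0 : 0 <= C2 by rewrite mulr_ge0 ?powR_ge0.
have Q0 : 0 < Q.
  by rewrite ltr_wpDl ?powR_ge0 // ltr0n muln_gt0 spread_gt0.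
exists (C1 + C2 + b%:R + Q); split; first by rewrite ltr_wpDl // !addr_ge0.
have b_ge0 : 0 <= b%:R :> R by [].
move=> C' CC'; split.
- move=> n x r r1 rd; split.
    apply: le_trans (growth_upper x r1) _; rewrite ler_wpM2r ?powR_ge0 //.
    by rewrite -/C2; lra.
  apply: le_trans (growth_lower x r1 rd) _; rewrite ler_wpM2r // -/C1; lra.
- move=> n; exists n.*2.+1; rewrite -leq_double; apply: leq_trans (diam_large _).
  have := ltn_expl n.*2.+1 (ltnW L_gt2); lia.
- by exists b%:R; split=> [|n]; [lra|apply: tiling_packed].
exists Q^-1; split; first by rewrite lef_pV2 ?posrE //; lra.
by move=> s s0 sK sP n x k k'; apply: many_paths sP.
Qed.

End Reals.

End Words.

(** * Choice of the parameters *)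

Local Open Scope ring_scope.

Lemma uniform_constant (R : realType) (P : nat -> R -> Prop) N :
  (forall c, exists C, 0 < C /\ forall C', C <= C' -> P c C') ->
  exists C, 0 < C /\ forall c, (c <= N)%N -> P c C.
Proof.
move=> Pc; suff [C [C0 CP]] : exists C, 0 < C /\
    forall c C', (c <= N)%N -> C <= C' -> P c C'.
  by exists C; split=> // c cN; apply: CP.
elim: N => [|N [C [C0 CP]]].
  by have [C [C0 CP]] := Pc 0%N; exists C; split=> // c C'; rewrite leqn0 => /eqP->; apply: CP.
have [D [D0 DP]] := Pc N.+1; exists (C + D); split; first by rewrite addr_gt0.
move=> c C'; rewrite leq_eqVlt => /orP[/eqP->|cN] le.
  by apply: DP; apply: le_trans le; rewrite lerDr ltW.
by apply: CP; rewrite //; apply: le_trans le; rewrite lerDl ltW.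
Qed.

(** The last bound equals [d - 1 + (k - d) * (1 - 1 / d)], and [1 / d <= 1 / (d - 1)]. *)
Lemma sdk_bounds (R : realType) (d : nat) (k : R) : (3 <= d)%N -> d%:R <= k ->
  0 <= sdk d k <= k /\ sdk d k <= k * (d%:R - 1) / d%:R.
Proof.
move=> d3 dk; have d3R : 3 <= d%:R :> R by rewrite (ler_nat R 3).
rewrite /sdk; move: (d%:R : R) d3R dk => D D3 Dk.
have i0 : 0 <= (D - 1)^-1 by rewrite invr_ge0; lra.
have i1 : (D - 1)^-1 <= 1 by rewrite invf_le1; lra.
have iD : D^-1 <= (D - 1)^-1 by rewrite lef_pV2 ?posrE; lra.
have -> : k * (D - 1) / D = D - 1 + (k - D) * (1 - D^-1) by field; lra.
split; last by rewrite lerD2l ler_wpM2l; lra.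
by apply/andP; split; nra.
Qed.

(* The family is required to have unbounded diameter, since the empty family or
   single-vertex graphs satisfy the three items vacuously.  For such a family
   the constant C cannot be uniform over all k >= d: item 1 bounds the degrees
   by C, while item 3 gives C^-1 * 2 `^ sdk d k <= #|gsphere x 2|.  So C depends
   on d, eps and an arbitrary upper bound K for k, but not on k itself. *)
Theorem theorem2p7 (R : realType) (d : nat) (eps K : R) :
  (3 <= d)%N -> 0 < eps ->
  exists C : R, 0 < C /\
  forall k : R, d%:R <= k -> k <= K ->
  exists F : sgraph -> Prop,
  [/\ forall n : nat, exists G : sgraph, F G /\ (n <= diam G)%N,
      exists kt : R, kt <= k + eps /\
        forall G : sgraph, F G ->
        forall (x : G) (r : R), 1 <= r -> r <= (diam G)%:R ->
          asymp C #|gball x r|%:R (r `^ kt),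
      exists M : R, M <= C /\
        forall G : sgraph, F G -> sphere_packed d M G &
      exists c : R, C^-1 <= c /\
        forall G : sgraph, F G ->
        forall (x : G) (m n : nat),
          (1 <= m)%N -> (m < n)%N -> n%:R <= c * (diam G)%:R ->
          exists ps : seq (seq G),
            vertex_disjoint_paths (gsphere x m) (gsphere x n) ps /\
            c * m%:R `^ sdk d k <= (size ps)%:R].
Proof.
case: d => [|[|[|e]]] // d3 eps0; set d := e.+3.
have D0 : 0 < d%:R :> R by rewrite ltr0n.
(* The factor [7] pays for rounding [b]: below, [b * L + 1 <= 7 * L * X k]. *)
have [L [L_odd L_gt2 L7]] : exists L, [/\ odd L, (2 < L)%N & 7 <= L%:R `^ (eps / d%:R)].
  have y0 : 0 <= 7 `^ (d%:R / eps) :> R by exact: powR_ge0.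
  have := archi_boundP y0; set N := Num.Def.archi_bound _ => yN.
  exists N.*2.+3; rewrite /= odd_double; split=> //.
  have -> : 7 = (7 `^ (d%:R / eps)) `^ (eps / d%:R) :> R.
    rewrite -powRrM -[LHS]powRr1 //; congr (_ `^ _); field.
    by rewrite !gt_eqF.
  rewrite ge0_ler_powR ?nnegrE ?divr_ge0 ?(ltW eps0) ?(ltW D0) //.
  by apply: le_trans (ltW yN) _; rewrite ler_nat; lia.
have L0 : 0 < L%:R :> R by rewrite ltr0n; lia.
have L1 : 1 <= L%:R :> R by rewrite ler1n; lia.
have L3 : 3 <= L%:R :> R by rewrite (ler_nat R 3).
(* [X k] is the ideal value of [b], for which the cube of side [b * L] has volume [L ^ k]. *)
pose X (k : R) := L%:R `^ (k / d%:R - 1).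
have XM k k' : k <= k' -> X k <= X k'.
  by move=> kk'; rewrite ler_powR // lerD2r ler_wpM2r // invr_ge0 ltW.
have LX k : L%:R * X k = L%:R `^ (k / d%:R).
  rewrite -{1}[L%:R]powRr1 ?(ltW L0) // -powRD; last by apply/implyP => _; rewrite gt_eqF.
  by congr (_ `^ _); ring.
(* With [b = 2 * half k + 1] one has [3 * X k <= b <= 3 * X k + 3]; as [L - 2 >= L / 3], the factor
   [3] gives [b * (L - 2) >= L * X k] in the path count. *)
pose half k := (Num.truncn (3 / 2 * X k)).+1.
pose b_odd c : odd c.*2.+1 := etrans (congr1 negb (odd_double c)) erefl.
(* As [k <= K], only finitely many odd [b] occur, so the constant can be chosen before [k]. *)
have [C [C0 CP]] := uniform_constant (half K)
  (fun c => tiling_bounds e (b_odd c) L_odd L_gt2 K).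
exists C; split=> // k dk kK; set c := half k.
have X0 : 0 <= 3 / 2 * X k by apply: mulr_ge0; [lra|exact: powR_ge0].
have X1 : 1 <= X k.
  have <- : X d%:R = 1 by rewrite /X divff ?gt_eqF // subrr powRr0.
  exact: XM.
have cK : (c <= half K)%N.
  by rewrite /c /half ltnS; apply: le_truncn; apply: ler_wpM2l; [lra|exact: XM].
have [balls large packed [cc [Ccc paths]]] := CP c cK.
have /andP[c1 c2] := truncn_itv X0.
have bE : c.*2.+1%:R = 2 * (Num.truncn (3 / 2 * X k))%:R + 3 :> R.
  by rewrite /c /half -muln2 -natr1 natrM -natr1; ring.
have [/andP[s0 sk] sd] := sdk_bounds d3 dk.
exists (fun G => exists n, G = tiling_graph e (b_odd c) L_odd L_gt2 n); split.
- by move=> n; have [m nm] := large n; eexists; split; [exists m|exact: nm].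
- exists (growth e c.*2.+1 L R); split; last by move=> _ [n ->]; exact: balls.
  apply: growth_le => //.
  have -> : L%:R `^ (k + eps) = (L%:R `^ (k / d%:R) * L%:R `^ (eps / d%:R)) ^+ d.
    rewrite -powRD; last by apply/implyP => _; rewrite gt_eqF.
    rewrite -powR_mulrn ?powR_ge0 // -powRrM; congr (_ `^ _); field.
    by rewrite gt_eqF.
  rewrite natrX lerXn2r ?nnegrE ?mulr_ge0 ?powR_ge0 //.
  have ineq (t y l E : R) : t <= 3 / 2 * y -> 1 <= y -> 1 <= l -> 7 <= E ->
      (2 * t + 3) * l + 1 <= l * y * E.
    move=> ty y1 l1 E7; have yl : 1 <= l * y by nra.
    have tl : (2 * t + 3) * l <= 6 * y * l by rewrite ler_wpM2r //; lra.
    by apply: (@le_trans _ _ (l * y * 7)); [lra|rewrite ler_wpM2l //; lra].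
  by rewrite -LX -natr1 natrM bE; apply: ineq.
- by have [M [MC MP]] := packed; exists M; split=> // _ [n ->].
exists cc; split=> // _ [n ->] x m m'; apply: paths s0 (le_trans sk kK) _ n x m m'.
apply: (@le_trans _ _ (L%:R `^ (k * (d%:R - 1) / d%:R))); first exact: ler_powR.
have -> : L%:R `^ (k * (d%:R - 1) / d%:R) = (L%:R `^ (k / d%:R)) ^+ e.+2.
  rewrite -powR_mulrn ?powR_ge0 // -powRrM; congr (_ `^ _).
  have -> : e.+2%:R = d%:R - 1 :> R by rewrite /d -[e.+3%:R]natr1 addrK.
  by field; rewrite gt_eqF.
rewrite natrX lerXn2r ?nnegrE ?powR_ge0 // -LX natrM bE natrB ?(ltnW L_gt2) //.
have ineq (t y l : R) : 3 / 2 * y < t + 1 -> 1 <= y -> 3 <= l ->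
  l * y <= (2 * t + 3) * (l - 2) by move=> *; nra.
by apply: ineq; rewrite ?natr1.
Qed.
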